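(* Let $\mathfrak{n},\mathfrak{h},\mathfrak{a}$ be nilpotent $\mathbb{F}_q$-algebras such that $U_\mathfrak{n}=U_\mathfrak{h}\ltimes U_\mathfrak{a}$ is a semidirect product of algebra groups with $U_\mathfrak{a}$ supernormal and $\mathfrak{a}^2=0$. Fix a set $\mathcal{R}$ of representatives of the distinct two-sided $U_\mathfrak{h}$-orbits of supercharacters of $U_\mathfrak{a}$. Each supercharacter of $U_\mathfrak{n}$ then corresponds to a unique pair $(\mathcal{O}_\tau,\mathcal{C}_\psi)$, where $\mathcal{O}_\tau$ denotes the two-sided $U_\mathfrak{h}$-orbit of a supercharacter $\tau\in\mathcal{R}$, and $\mathcal{C}_\psi$ denotes the $\sim_\tau$-equivalence class of a supercharacter $\psi$ of $S_\tau$. In particular, the map $$\{\text{supercharacters of }U_\mathfrak{n}\}\to\{(\mathcal{O}_\tau,\mathcal{C}_\psi):\tau\in\mathcal{R}\text{ and }\psi\text{ a supercharacter of }S_\tau\},$$ $$\chi_\mathfrak{n}^\lambda\mapsto(\mathcal{O}_\tau,\mathcal{C}_\psi),\quad\text{where }\tau=\chi_\mathfrak{a}^{\lambda\downarrow\mathfrak{a}}\in\mathcal{R},\ \psi=\chi_{\mathfrak{s}_\tau}^{\lambda\downarrow\mathfrak{s}_\tau},$$ (defined by indexing each supercharacter of $U_\mathfrak{n}$ by some $\lambda\in\mathfrak{n}^*$ with $\chi_\mathfrak{a}^{\lambda\downarrow\mathfrak{a}}\in\mathcal{R}$, which is always possible) is a bijection, with inverse $(\mathcal{O}_\tau,\mathcal{C}_\psi)\mapsto\chi$,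 where $\chi$ is the supercharacter of $U_\mathfrak{n}$ determined by the identity $$m_\chi\chi=\mathrm{SInd}_{U_\mathfrak{a}S_\tau}^{U_\mathfrak{n}}\Bigl(\sum_{\vartheta\in\mathcal{C}_\psi}m_\vartheta|\mathcal{O}_\tau|\,\tilde\vartheta\otimes\tilde\tau\Bigr),\quad\text{where }m_\vartheta=\frac{\vartheta(1)}{\langle\vartheta,\vartheta\rangle_{S_\tau}},\ m_\chi=\frac{\chi(1)}{\langle\chi,\chi\rangle_{U_\mathfrak{n}}}.$$ Here $m_\chi$ and $m_\vartheta$ denote the multiplicities of $\chi$ and $\vartheta$ in the characters of $\mathbb{C}U_\mathfrak{n}$ and $\mathbb{C}S_\tau$, and $\tilde\vartheta$ and $\tilde\tau$ are the characters of $U_\mathfrak{a}S_\tau$ defined by $\tilde\vartheta(as)=\vartheta(s)$ and $\tilde\tau(as)=\tau(a)$ for $a\in U_\mathfrak{a}$, $s\in S_\tau$.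
   Context: $\mathbb{F}_q$ is a finite field; all algebras are finite-dimensional associative $\mathbb{F}_q$-algebras. For a nilpotent $\mathbb{F}_q$-algebra $\mathfrak{n}$, the algebra group is $U_\mathfrak{n}=\{1+X:X\in\mathfrak{n}\}$ with multiplication $(1+X)(1+Y)=1+X+Y+XY$. It acts on $\mathfrak{n}$ by $(1+X)Y=Y+XY$, $Y(1+X)=Y+YX$, and on the dual space $\mathfrak{n}^*$ by $g\lambda(X)=\lambda(g^{-1}X)$, $\lambda g(X)=\lambda(Xg^{-1})$; the two actions commute. The superclass of $g\in U_\mathfrak{n}$ is $\{1+x(g-1)y:x,y\in U_\mathfrak{n}\}$; a subgroup is supernormal if it is a union of superclasses. Fix a nontrivial homomorphism $\theta:\mathbb{F}_q^+\to\mathbb{C}^\times$. The supercharacters of $U_\mathfrak{n}$ are, for $\lambda\in\mathfrak{n}^*$, $$\chi_\mathfrak{n}^\lambda(g)=\frac{|U_\mathfrak{n}\lambda|}{|U_\mathfrak{n}\lambda U_\mathfrak{n}|}\sum_{\mu\in U_\mathfrak{n}\lambda U_\mathfrak{n}}\theta\circ\mu(g-1);$$ $\chi_\mathfrak{n}^\lambda=\chi_\mathfrak{n}^\mu$ iff $\mu\in U_\mathfrak{n}\lambda U_\mathfrak{n}$. $\langle\cdot,\cdot\rangle_G$ is the usual inner product $\frac{1}{|G|}\sum_{g\in G}\chi(g)\overline{\psi(g)}$, and $f\downarrow S'$ is the restriction of a function $f$ to $S'$. For algebra groups $U_\mathfrak{m}\subset U_\mathfrak{n}$ and a superclass function $\chi$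 on $U_\mathfrak{m}$, $\mathrm{SInd}_{U_\mathfrak{m}}^{U_\mathfrak{n}}(\chi)(g)=\frac{1}{|U_\mathfrak{m}||U_\mathfrak{n}|}\sum_{x,y\in U_\mathfrak{n}}\overset{\circ}{\chi}(x(g-1)y+1)$, where $\overset{\circ}{\chi}$ equals $\chi$ on $U_\mathfrak{m}$ and $0$ elsewhere. Setting of the theorem: $\mathfrak{h}$ is a subalgebra and $\mathfrak{a}$ a two-sided ideal of $\mathfrak{n}$, with $\mathfrak{n}=\mathfrak{h}\oplus\mathfrak{a}$ as a vector space. Supercharacters of the abelian group $U_\mathfrak{a}$ coincide with its irreducible (linear) characters. $U_\mathfrak{h}$ acts compatibly on the left and right on them by $g\tau h(1+A)=\tau(1+g^{-1}Ah^{-1})$ for $g,h\in U_\mathfrak{h}$, $A\in\mathfrak{a}$; the two-sided $U_\mathfrak{h}$-orbit of $\tau$ is $\{g\tau h:g,h\in U_\mathfrak{h}\}$. For a supercharacter $\tau$ of $U_\mathfrak{a}$, let $L_\tau,R_\tau$ be its left and right stabilizers in $U_\mathfrak{h}$, $S_\tau=L_\tau\cap R_\tau$, and $T_\tau=\{(g,h)\in U_\mathfrak{h}\times U_\mathfrak{h}:g\tau h^{-1}=\tau\}$. Then $S_\tau=1+\mathfrak{s}_\tau$ is an algebra group for a subalgebra $\mathfrak{s}_\tau\subset\mathfrak{h}$, and $\mathfrak{s}_\tau$ is closed under $X\mapsto gXh^{-1}$ for $(g,h)\in T_\tau$; so $T_\tau$ acts on $\mathfrak{s}_\tau^*$ by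 $(g,h)\cdot\eta(X)=\eta(g^{-1}Xh)$. The equivalence relation $\sim_\tau$ on the supercharacters of $S_\tau$ is defined by $\chi_{\mathfrak{s}_\tau}^\mu\sim_\tau\chi_{\mathfrak{s}_\tau}^\nu$ if and only if $\mu\in T_\tau\cdot\nu$, for $\mu,\nu\in\mathfrak{s}_\tau^*$. The product $U_\mathfrak{a}S_\tau$ is the algebra group $U_{\mathfrak{a}+\mathfrak{s}_\tau}$. *)

(* Defs.v *)
From HB Require Import structures.
From mathcomp Require Import all_boot all_order all_algebra.
From mathcomp Require Import all_fingroup all_solvable.
From mathcomp Require Import finmap.

Set Implicit Arguments.
Unset Strict Implicit.
Unset Printing Implicit Defensive.

Import GRing.Theory Num.Theory.
Local Open Scope ring_scope.

(* Finite-dimensional nilpotent associative algebras over a finite field.     *)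
(* They have no unit, so they are not instances of the ring hierarchy.        *)
(* Finiteness of the carrier follows from finite dimension over F and is      *)
(* included to make the library of finite sets and groups available.          *)
HB.mixin Record isNilpotentAlgebra (F : finFieldType) V
    of Vector F V & Finite V := {
  nmul : V -> V -> V;
  nmulA : associative nmul;
  nmul_linearr : forall x, linear (nmul x);
  nmul_linearl : forall y, linear (nmul^~ y);
  nmul_nilpotent :
    exists k, forall x (s : seq V), size s = k -> foldl nmul x s = 0
}.

#[short(type="nilAlgType")]
HB.structure Definition NilpotentAlgebra (F : finFieldType) :=
  {V of isNilpotentAlgebra F V & Vector F V & Finite V}.

Section NilpotentAlgebraTheory.
Variables (F : finFieldType) (n : nilAlgType F).
Local Notation "x ** y" := (@nmul F n x y) (at level 40, left associativity).
Implicit Types x y z : n.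

Lemma nmulDr x y z : x ** (y + z) = x ** y + x ** z.
Proof. by have := nmul_linearr x 1 y z; rewrite !scale1r. Qed.

Lemma nmulDl x y z : (x + y) ** z = x ** z + y ** z.
Proof. by have /= := nmul_linearl z 1 x y; rewrite !scale1r. Qed.

Lemma nmulx0 x : x ** 0 = 0.
Proof. by apply: (addrI (x ** 0)); rewrite -nmulDr !addr0. Qed.

Lemma nmul0x x : 0 ** x = 0.
Proof. by apply: (addrI (0 ** x)); rewrite -nmulDl !addr0. Qed.

Lemma nmulNx x y : (- x) ** y = - (x ** y).
Proof. by apply: (addrI (x ** y)); rewrite -nmulDl !subrr nmul0x. Qed.

Lemma nmulZl c x y : (c *: x) ** y = c *: (x ** y).
Proof. by have /= := nmul_linearl y c x 0; rewrite nmul0x !addr0. Qed.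

Lemma quasi_inverse_subproof x : exists y, y + x + y ** x == 0.
Proof.
have [k nilk] := @nmul_nilpotent F n.
have key m : exists y c,
    y + x + y ** x = c *: foldl (@nmul F n) x (nseq m x).
  elim: m => [|m [y [c IH]]].
    by exists 0, 1; rewrite nmul0x addr0 add0r scale1r.
  exists (- (x + y ** x)), (- c).
  have -> : nseq m.+1 x = nseq m x ++ [:: x] by rewrite -addn1 nseqD.
  rewrite foldl_cat /= scaleNr -nmulZl -IH nmulNx !nmulDl.
  rewrite [- (x + _)]opprD [- x - _ + x]addrAC addNr add0r -opprD.
  by congr (- _); rewrite -addrA.
have [y [c eq_y]] := key k; exists y.
by rewrite eq_y nilk ?size_nseq ?scaler0.
Qed.

End NilpotentAlgebraTheory.

(* The group of all 1 + X for X in n; OnePlus X stands for 1 + X and          *)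
(* minus1 g for g - 1.                                                        *)
Record algU (F : finFieldType) (n : nilAlgType F) :=
  OnePlus { minus1 : n }.
Arguments OnePlus {F n} minus1.

HB.instance Definition _ (F : finFieldType) (n : nilAlgType F) :=
  [isNew for @minus1 F n].
HB.instance Definition _ (F : finFieldType) (n : nilAlgType F) :=
  [Finite of algU n by <:].

Section AlgebraGroupType.
Variables (F : finFieldType) (n : nilAlgType F).
Implicit Types g h : algU n.

Definition algU_mul g h :=
  OnePlus (minus1 g + minus1 h + nmul (minus1 g) (minus1 h)).
Definition algU_one : algU n := OnePlus 0.
Definition algU_inv g : algU n :=
  OnePlus (xchoose (quasi_inverse_subproof (minus1 g))).

Lemma algU_mulA : associative algU_mul.
Proof.
move=> g h k; rewrite /algU_mul /=; congr OnePlus.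
rewrite !nmulDr !nmulDl nmulA !addrA.
by rewrite [LHS](ACl (1*2*5*3*6*4*7)).
Qed.

Lemma algU_mul1 : left_id algU_one algU_mul.
Proof. by case=> x; rewrite /algU_mul /= nmul0x add0r addr0. Qed.

Lemma algU_mulV : left_inverse algU_one algU_inv algU_mul.
Proof.
case=> x; congr OnePlus; apply/eqP.
exact: (xchooseP (quasi_inverse_subproof x)).
Qed.

HB.instance Definition _ :=
  Finite_isGroup.Build (algU n) algU_mulA algU_mul1 algU_mulV.

End AlgebraGroupType.

Section AlgebraGroups.
Variables (F : finFieldType) (n : nilAlgType F).
Implicit Types (m : {set n}) (g h x y : algU n).

Definition subalgebra m :=
  GRing.submod_closed m /\ {in m &, forall X Y, nmul X Y \in m}.

Definition alg_group m : {set algU n} := [set OnePlus X | X in m].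

Definition lact g (X : n) : n := X + nmul (minus1 g) X.
Definition ract (X : n) g : n := X + nmul X (minus1 g).
Definition biact g (X : n) h : n := ract (lact g X) h.

Definition superclass g : {set algU n} :=
  [set OnePlus (biact x (minus1 g) y) | x : algU n, y : algU n].

Definition supernormal (H : {set algU n}) :=
  exists K : {set algU n}, H = \bigcup_(g in K) superclass g.

(* A linear functional on m is encoded by its extension by 0 outside of m, so *)
(* that the duals of all subalgebras of n live in one finite type.            *)
Definition dual m : {set {ffun n -> F}} :=
  [set l : {ffun n -> F} |
     [forall c : F, forall X in m, forall Y in m,
        l (c *: X + Y) == c * l X + l Y]
     && [forall X, (X \notin m) ==> (l X == 0)]].

Definition restrict (l : {ffun n -> F}) m : {ffun n -> F} :=
  [ffun X => if X \in m then l X else 0].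

Definition dual_act g (l : {ffun n -> F}) h : {ffun n -> F} :=
  [ffun X => l (biact g^-1%g X h^-1%g)].

Definition dual_lorbit m (l : {ffun n -> F}) : {set {ffun n -> F}} :=
  [set dual_act g l 1%g | g in alg_group m].

Definition dual_orbit m (l : {ffun n -> F}) : {set {ffun n -> F}} :=
  [set dual_act g l h | g in alg_group m, h in alg_group m].

End AlgebraGroups.

Definition additive_character (F : finFieldType) (C : numClosedFieldType)
    (theta : F -> C) :=
  (forall s t, theta (s + t) = theta s * theta t) /\
  (forall s, theta s != 0).

Section Supercharacters.
Variables (F : finFieldType) (n : nilAlgType F) (C : numClosedFieldType).
Variable theta : F -> C.

(* A function on a subset of U_n is encoded by its extension by 0.            *)
Local Notation gfun := {ffun algU n -> C}.
Implicit Types (m : {set n}) (H G A S : {set algU n}) (g h x y : algU n).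
Implicit Types (chi psi tau : gfun).

Definition supercharacter m (l : {ffun n -> F}) : gfun :=
  [ffun g => if g \in alg_group m then
      #|dual_lorbit m l|%:R / #|dual_orbit m l|%:R
        * \sum_(mu in dual_orbit m l) theta (mu (minus1 g))
    else 0].

Definition supercharacters m : {fset gfun} :=
  [fset supercharacter m l | l in dual m]%fset.

Definition inner_prod G chi psi : C :=
  #|G|%:R^-1 * \sum_(g in G) chi g * (psi g)^*.

Definition multiplicity G chi : C := chi 1%g / inner_prod G chi chi.

Definition regular_character G : gfun :=
  [ffun g => if g == 1%g then #|G|%:R else 0].

Definition SInd H G (chi : algU n -> C) g : C :=
  (#|H|%:R * #|G|%:R)^-1 *
    \sum_(x in G) \sum_(y in G)
      let u := OnePlus (biact x (minus1 g) y) in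
      if u \in H then chi u else 0.

Definition char_act g tau h : gfun :=
  [ffun u => tau (OnePlus (biact g^-1%g (minus1 u) h^-1%g))].

Definition char_orbit H tau : {fset gfun} :=
  [fset char_act gh.1 tau gh.2 | gh in setX H H]%fset.

Definition lstab H tau : {set algU n} :=
  [set g in H | char_act g tau 1%g == tau].
Definition rstab H tau : {set algU n} :=
  [set g in H | char_act 1%g tau g == tau].
Definition bistab H tau : {set algU n} := lstab H tau :&: rstab H tau.

Definition bistab_alg H tau : {set n} := [set minus1 g | g in bistab H tau].

Definition tstab H tau : {set algU n * algU n} :=
  [set gh in setX H H | char_act gh.1 tau gh.2^-1%g == tau].

Definition tstab_act (gh : algU n * algU n) (eta : {ffun n -> F}) :
    {ffun n -> F} :=
  [ffun X => eta (biact gh.1^-1%g X gh.2)].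

Definition tau_equiv H tau : rel gfun := fun psi1 psi2 =>
  let s := bistab_alg H tau in
  [exists mu in dual s, exists nu in dual s,
    [&& psi1 == supercharacter s mu, psi2 == supercharacter s nu
      & mu \in [set tstab_act gh nu | gh in tstab H tau]]].

Definition tau_class H tau psi : {fset gfun} :=
  [fset phi in supercharacters (bistab_alg H tau)
     | tau_equiv H tau phi psi]%fset.

(* remgr A S u and divgr A S u are the factors s and a of u = a * s.          *)
Definition tilde_S A S (psi : gfun) : gfun := [ffun u => psi (remgr A S u)].
Definition tilde_a A S (tau : gfun) : gfun := [ffun u => tau (divgr A S u)].

Definition orbit_representatives (h a : {set n}) (R : {fset gfun}) :=
  (R `<=` supercharacters a)%fset /\
  forall sigma, sigma \in supercharacters a ->
    exists! tau, tau \in R /\ sigma \in char_orbit (alg_group h) tau.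

Definition orbit_class_pairs (h : {set n}) (R : {fset gfun}) :
    {fset {fset gfun} * {fset gfun}} :=
  [fset (char_orbit (alg_group h) tau, tau_class (alg_group h) tau psi)
     | tau in R,
       psi in supercharacters (bistab_alg (alg_group h) tau)]%fset.

End Supercharacters.

(* Main.v *)
Require Import Defs.
From HB Require Import structures.
From mathcomp Require Import all_boot all_order all_algebra.
From mathcomp Require Import all_fingroup all_solvable.
From mathcomp Require Import finmap ring.

(**
  Write nu for the restriction to a of a functional l on n, and tau for the
  linear character theta o nu of U_a. Because a is an ideal of square zero,
  acting on l by the inverses of 1 + A and 1 + B, for A and B in a, leaves nu
  alone and adds to l the functional X |-> nu (A X + X B). These functionals
  form a linear space; its common kernel, the radical of nu, is a + s_tau, so
  by duality they are all the functionals that vanish on a and on s_tau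
  (ideal_orbit). Hence a two-sided U_a-orbit consists of all functionals with
  a given restriction to a and to s_tau. The remaining action of U_h moves nu
  within its orbit, and the pairs
  that fix nu are those of T_tau, acting on the restriction to s_tau. So two
  functionals that both restrict to nu lie in one U_n-orbit exactly when their
  restrictions to s_tau give equivalent supercharacters (tau_equiv_orbit).
  Since functionals on a and on s_tau have a common extension to n, choosing
  one tau in each orbit makes l |-> (O_tau, C_psi) a bijection from the
  two-sided orbits of U_n, that is from its supercharacters, to the pairs.

  For the formula, m_chi * chi is the plain sum of theta o mu over the orbit
  of functionals indexing chi (multiplicity_mul_supercharacter). The same fact
  on S_tau rewrites the function to be induced as #|O_tau| times a sum of
  theta o kappa over functionals kappa on the radical, extended by zero. Each
  such term is, up to the factor #|radical| / #|n|, the sum of theta o l over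
  all extensions l of kappa to n (sum_theta_extensions), and the extensions
  that occur are the members of the orbit of l that restrict to nu. Averaging
  over U_n on both sides makes of each of them the average over the whole
  orbit, and card_char_orbit shows that the constants cancel. As a sum of
  functions theta o mu determines the set of mu that occur, the identity
  singles out chi. The multiplicities in the regular characters follow by
  summing theta o mu over all functionals mu at once.

  All linear duality (extending functionals, size of the dual, double
  annihilators) is derived by counting, from the orthogonality of the
  functions theta o l: a sum of theta o l over a subspace is either the size
  of the subspace or zero.
*)

Set Implicit Arguments.
Unset Strict Implicit.
Unset Printing Implicit Defensive.

Import GRing.Theory Num.Theory.
Local Open Scope ring_scope.

(** * Two-sided actions of an algebra group *)

Section Actions.
Variables (F : finFieldType) (n : nilAlgType F).
Implicit Types (m : {set n}) (g h x y : algU n) (X Y Z : n).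
Implicit Types l : {ffun n -> F}.

Lemma nmulZr c X Y : nmul X (c *: Y) = c *: nmul X Y.
Proof. by have := nmul_linearr X c Y 0; rewrite nmulx0 !addr0. Qed.

Lemma minus1M g h :
  minus1 (g * h)%g = minus1 g + minus1 h + nmul (minus1 g) (minus1 h).
Proof. by []. Qed.

Lemma minus1_1 : minus1 (1%g : algU n) = 0.
Proof. by []. Qed.

Lemma OnePlusK g : OnePlus (minus1 g) = g.
Proof. by case: g. Qed.

Lemma OnePlus_inj : injective (@OnePlus F n).
Proof. by move=> X Y []. Qed.

Lemma biactE g X h :
  biact g X h = X + nmul (minus1 g) X + nmul X (minus1 h)
                + nmul (nmul (minus1 g) X) (minus1 h).
Proof. by rewrite /biact /Defs.ract /lact nmulDl addrA. Qed.

Lemma biact1 X : biact 1%g X 1%g = X.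
Proof. by rewrite biactE minus1_1 !nmul0x nmulx0 !addr0. Qed.

Lemma biactM g g' X h h' :
  biact g (biact g' X h') h = biact (g * g')%g X (h' * h)%g.
Proof.
rewrite !biactE !minus1M !(nmulDl, nmulDr) !nmulA !addrA.
by rewrite [LHS](ACl (1*5*2*6*3*9*11*7*13*15*4*10*12*8*14*16)).
Qed.

Lemma biactP g c X Y h :
  biact g (c *: X + Y) h = c *: biact g X h + biact g Y h.
Proof.
rewrite !biactE !(nmulDl, nmulDr, nmulZl, nmulZr) !scalerDr !addrA.
by rewrite [LHS](ACl (1*3*5*7*2*4*6*8)).
Qed.

Lemma biactK g X h : biact g^-1%g (biact g X h) h^-1%g = X.
Proof. by rewrite biactM mulVg mulgV biact1. Qed.

Lemma biactVK g X h : biact g (biact g^-1%g X h^-1%g) h = X.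
Proof. by rewrite biactM mulVg mulgV biact1. Qed.

Lemma nmul_lact X Y : nmul X Y = biact (OnePlus X) Y 1%g - Y.
Proof. by rewrite biactE minus1_1 !nmulx0 !addr0 addrC addKr. Qed.

Lemma nmul_ract X Y : nmul X Y = biact 1%g X (OnePlus Y) - X.
Proof. by rewrite biactE minus1_1 !nmul0x !addr0 addrC addKr. Qed.

Lemma biact_nmul g X Y h :
  biact g (nmul X Y) h = nmul (biact g X 1%g) (biact 1%g Y h).
Proof.
rewrite !biactE minus1_1 !(nmulx0, nmul0x) !addr0.
rewrite !(nmulDl, nmulDr) !nmulA !addrA.
by rewrite [LHS](ACl (1*3*2*4)).
Qed.

Lemma nmul_biact_mid X g Y : nmul (biact 1%g X g) Y = nmul X (biact g Y 1%g).
Proof.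
by rewrite !biactE minus1_1 !(nmulx0, nmul0x) !addr0 nmulDl nmulDr nmulA.
Qed.

Lemma dual_actE g l h X : dual_act g l h X = l (biact g^-1%g X h^-1%g).
Proof. by rewrite ffunE. Qed.

Lemma dual_act1 l : dual_act 1%g l 1%g = l.
Proof. by apply/ffunP=> X; rewrite dual_actE invg1 biact1. Qed.

Lemma dual_actM g g' l h h' :
  dual_act g (dual_act g' l h') h = dual_act (g * g')%g l (h' * h)%g.
Proof. by apply/ffunP=> X; rewrite !dual_actE biactM !invMg. Qed.

Lemma dual_actK g l h : dual_act g^-1%g (dual_act g l h) h^-1%g = l.
Proof. by rewrite dual_actM mulVg mulgV dual_act1. Qed.

Lemma dual_act_inj g h : injective (fun l => dual_act g l h).
Proof.
apply: (can_inj (g := fun l => dual_act g^-1%g l h^-1%g)) => l.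
exact: dual_actK.
Qed.

Lemma mem_alg_group m g : (g \in alg_group m) = (minus1 g \in m).
Proof.
apply/imsetP/idP => [[X mX ->] // | mg].
by exists (minus1 g); rewrite ?OnePlusK.
Qed.

Lemma card_alg_group m : #|alg_group m| = #|m|.
Proof. exact: card_imset OnePlus_inj. Qed.

Lemma alg_groupT : alg_group [set: n] = [set: algU n].
Proof. by apply/setP=> g; rewrite mem_alg_group !inE. Qed.

End Actions.

(** * Subalgebras and their duals *)

Lemma subspT (F : finFieldType) (n : nilAlgType F) :
  GRing.submod_closed [set: n].
Proof. by split=> [|c X Y _ _]; rewrite in_setT. Qed.

Lemma subalgT (F : finFieldType) (n : nilAlgType F) : subalgebra [set: n].
Proof. by split=> [|X Y _ _]; [apply: subspT | rewrite in_setT]. Qed.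

Section Subspaces.
Variables (F : finFieldType) (n : nilAlgType F) (m : {set n}).
Hypothesis m_sub : GRing.submod_closed m.
Implicit Types (X Y : n) (l : {ffun n -> F}).

Lemma subsp0 : 0 \in m. Proof. by case: m_sub. Qed.

Lemma subspP c X Y : X \in m -> Y \in m -> c *: X + Y \in m.
Proof. by case: m_sub => _; apply. Qed.

Lemma subspD X Y : X \in m -> Y \in m -> X + Y \in m.
Proof. by move=> mX mY; rewrite -[X]scale1r subspP. Qed.

Lemma subspZ c X : X \in m -> c *: X \in m.
Proof. by move=> mX; rewrite -[_ *: X]addr0 subspP ?subsp0. Qed.

Lemma subspN X : X \in m -> - X \in m.
Proof. by rewrite -scaleN1r; apply: subspZ. Qed.

Lemma subspB X Y : X \in m -> Y \in m -> X - Y \in m.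
Proof. by move=> mX mY; rewrite subspD ?subspN. Qed.

Lemma dualP l : reflect
  ((forall c, {in m &, forall X Y, l (c *: X + Y) = c * l X + l Y})
   /\ (forall X, X \notin m -> l X = 0)) (l \in dual m).
Proof.
rewrite inE; apply: (iffP andP) => [[/forallP lin /forallP out] | [lin out]].
  split=> [c X Y mX mY | X mX]; last by apply/eqP/(implyP (out X)).
  by have /forall_inP/(_ X mX)/forall_inP/(_ Y mY)/eqP := lin c.
split; last by apply/forallP=> X; apply/implyP=> mX; rewrite out.
apply/forallP=> c; apply/forall_inP=> X mX; apply/forall_inP=> Y mY.
by rewrite lin.
Qed.

Section Functional.
Variable l : {ffun n -> F}.
Hypothesis l_dual : l \in dual m.

Lemma dual_lin c X Y : X \in m -> Y \in m -> l (c *: X + Y) = c * l X + l Y.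
Proof. by case/dualP: l_dual => lin _; apply: lin. Qed.

Lemma dual_out X : X \notin m -> l X = 0.
Proof. by case/dualP: l_dual => _; apply. Qed.

Lemma dualD X Y : X \in m -> Y \in m -> l (X + Y) = l X + l Y.
Proof. by move=> mX mY; rewrite -[X]scale1r dual_lin // scale1r mul1r. Qed.

Lemma dual0 : l 0 = 0.
Proof. by apply: (addrI (l 0)); rewrite -dualD ?subsp0 // !addr0. Qed.

Lemma dualZ c X : X \in m -> l (c *: X) = c * l X.
Proof.
by move=> mX; rewrite -[c *: X]addr0 dual_lin ?subsp0 // dual0 addr0.
Qed.

Lemma dualN X : X \in m -> l (- X) = - l X.
Proof. by move=> mX; rewrite -scaleN1r dualZ // mulN1r. Qed.

End Functional.

Lemma dual_zero : [ffun=> 0] \in dual m.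
Proof.
by apply/dualP; split=> [c X Y mX mY | X mX]; rewrite !ffunE // mulr0 addr0.
Qed.

Lemma dual_comb c l l' :
  l \in dual m -> l' \in dual m -> [ffun X => c * l X + l' X] \in dual m.
Proof.
move=> dl dl'; apply/dualP; split=> [d X Y mX mY | X mX]; rewrite !ffunE.
  by rewrite !dual_lin // !mulrDr addrACA !mulrA [c * d]mulrC.
by rewrite !dual_out // mulr0 addr0.
Qed.

Lemma dual_eq l l' :
  l \in dual m -> l' \in dual m -> {in m, l =1 l'} -> l = l'.
Proof.
move=> dl dl' eq_ll'; apply/ffunP=> X.
by have [/eq_ll' // | mX] := boolP (X \in m); rewrite !dual_out.
Qed.

Lemma dual_act_dual g l h :
  (forall X, (biact g^-1%g X h^-1%g \in m) = (X \in m)) ->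
  l \in dual m -> dual_act g l h \in dual m.
Proof.
move=> stab dl; apply/dualP; split=> [c X Y mX mY | X mX]; rewrite !dual_actE.
  by rewrite biactP dual_lin ?stab.
by rewrite dual_out ?stab.
Qed.

Lemma restrictE l X : X \in m -> restrict l m X = l X.
Proof. by move=> mX; rewrite ffunE mX. Qed.

Lemma restrict_dual (k : {set n}) l :
  m \subset k -> l \in dual k -> restrict l m \in dual m.
Proof.
move=> /subsetP mk /[dup] dl; rewrite inE => /andP[/forallP lin _].
apply/dualP; split=> [c X Y mX mY | X mX]; last by rewrite ffunE (negPf mX).
rewrite !restrictE ?subspP //.
by have /forall_inP/(_ X (mk X mX))/forall_inP/(_ Y (mk Y mY))/eqP := lin c.
Qed.

End Subspaces.

Section Subalgebras.
Variables (F : finFieldType) (n : nilAlgType F) (m : {set n}).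
Hypothesis m_alg : subalgebra m.
Implicit Types (X Y : n) (l : {ffun n -> F}).
Local Notation U := (alg_group m).

Lemma subalg_sub : GRing.submod_closed m. Proof. by case: m_alg. Qed.
Let m_sub := subalg_sub.

Lemma subalgM X Y : X \in m -> Y \in m -> nmul X Y \in m.
Proof. by case: m_alg => _; apply. Qed.

(** Inverses come for free: a subset of a finite group that contains 1 and is
    closed under products is a subgroup. *)
Lemma alg_group_group_set : group_set U.
Proof.
apply/group_setP; split=> [|g h]; rewrite !mem_alg_group ?minus1_1 ?subsp0 //.
by rewrite minus1M => mg mh; rewrite !(subspD m_sub) ?subalgM.
Qed.

Definition alg_group_group := Group alg_group_group_set.

Lemma alg_group1 : 1%g \in U.
Proof. exact: (@group1 _ alg_group_group). Qed.

Lemma alg_groupM g h : g \in U -> h \in U -> (g * h)%g \in U.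
Proof. exact: (@groupM _ alg_group_group). Qed.

Lemma alg_groupV g : (g^-1%g \in U) = (g \in U).
Proof. exact: (@groupV _ alg_group_group). Qed.

Lemma biact_mem g X h :
  g \in U -> h \in U -> (biact g X h \in m) = (X \in m).
Proof.
have stab x Y y : x \in U -> y \in U -> Y \in m -> biact x Y y \in m.
  rewrite !mem_alg_group => mx my mY.
  by rewrite biactE !(subspD m_sub) ?subalgM ?subalgM.
move=> Ug Uh; apply/idP/idP => [mX | ]; last exact: stab.
by rewrite -(biactK g X h) stab ?alg_groupV.
Qed.

End Subalgebras.

(** * Duality through the additive character *)

(** Reindexing by s multiplies the sum by c, so (c - 1) kills it. Every
    orthogonality relation below is an instance, s being a translation. *)
Lemma sum_quasi_invariant_eq0 (T : finType) (C : idomainType) (A : {set T})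
    (s : T -> T) (f : T -> C) (c : C) :
    injective s -> {in A, forall x, s x \in A} ->
    {in A, forall x, f (s x) = c * f x} -> c != 1 ->
  \sum_(x in A) f x = 0.
Proof.
move=> s_inj As fs c_neq1.
have sA : s @: A = A.
  apply/eqP; rewrite eqEcard card_imset // leqnn andbT.
  by apply/subsetP=> _ /imsetP[x Ax ->]; apply: As.
have : (c - 1) * \sum_(x in A) f x = 0.
  apply/eqP; rewrite mulrBl mul1r subr_eq0 -{2}sA big_imset /=; last first.
    by move=> x y _ _; apply: s_inj.
  by rewrite mulr_sumr; apply/eqP/eq_bigr=> x Ax; rewrite fs.
by move/eqP; rewrite mulf_eq0 subr_eq0 (negPf c_neq1) /= => /eqP.
Qed.

Section Duality.
Variables (F : finFieldType) (n : nilAlgType F) (C : numClosedFieldType).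
Variable theta : F -> C.
Hypothesis theta_char : additive_character theta.
Hypothesis theta_nontrivial : exists t, theta t != 1.
Implicit Types (X Y : n) (l : {ffun n -> F}) (s t : F).

Lemma thetaD s t : theta (s + t) = theta s * theta t.
Proof. by case: theta_char. Qed.

Lemma theta_neq0 s : theta s != 0.
Proof. by case: theta_char. Qed.

Lemma theta0 : theta 0 = 1.
Proof. by apply: (mulfI (theta_neq0 0)); rewrite -thetaD addr0 mulr1. Qed.

Lemma thetaN s : theta (- s) = (theta s)^-1.
Proof.
apply: (mulfI (theta_neq0 s)).
by rewrite -thetaD subrr theta0 mulfV ?theta_neq0.
Qed.

(** F is a finite additive group, so the values of theta are roots of unity,
    whose conjugates are their inverses. *)
Lemma theta_conj s : (theta s)^* = theta (- s).
Proof.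
have thetaMn k : theta (s *+ k) = theta s ^+ k.
  by elim: k => [|k IH]; rewrite ?mulr0n ?theta0 // mulrS thetaD IH exprS.
have theta_norm1 : `|theta s| = 1.
  have /eqP := expg_cardG (in_setT s); rewrite FinRing.zmodXgE => /eqP s_tors.
  have F_gt0 : (0 < #|[set: F]|)%N by apply/card_gt0P; exists 0; rewrite inE.
  apply/eqP; rewrite -(pexpr_eq1 F_gt0) ?normr_ge0 //.
  by rewrite -normrX -thetaMn s_tors theta0 normr1.
by rewrite thetaN invC_norm theta_norm1 expr1n invr1 mul1r.
Qed.

Lemma sum_theta_functionals (m : {set n}) l l' : GRing.submod_closed m ->
    l \in dual m -> l' \in dual m ->
  \sum_(X in m) theta (l X) * theta (- l' X)
    = if l == l' then #|m|%:R else 0.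
Proof.
move=> m_sub dl dl'; case: eqP => [<- | neq].
  rewrite (eq_bigr (fun=> 1)) ?sumr_const // => X _.
  by rewrite -thetaD subrr theta0.
have [X0 mX0 lX0] : exists2 X0, X0 \in m & l X0 != l' X0.
  apply/exists_inP; apply: contra_notT neq => /exists_inPn eq_ll'.
  by apply: (dual_eq dl dl') => X mX; apply/eqP/negPn/eq_ll'.
have [t theta_t] := theta_nontrivial.
pose Y := (t / (l X0 - l' X0)) *: X0.
have mY : Y \in m by apply: subspZ.
apply: (@sum_quasi_invariant_eq0 _ _ _ (fun X => Y + X) _ (theta t)) => //.
- exact: addrI.
- by move=> X mX; apply: subspD.
- move=> X mX /=; rewrite (dualD dl) // (dualD dl') // -!thetaD; congr theta.
  rewrite (dualZ m_sub dl) // (dualZ m_sub dl') // opprD addrACA -mulrBr.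
  by rewrite divfK ?subr_eq0.
Qed.

Lemma exists_dual (m : {set n}) X t : GRing.submod_closed m ->
  X \in m -> X != 0 -> exists2 l, l \in dual m & l X = t.
Proof.
move=> m_sub mX X_neq0; pose x i := coord (vbasis {:n}) i.
have [i Xi] : exists i, x i X != 0.
  apply/existsP; apply: contraNT X_neq0 => /existsPn X0; apply/eqP.
  rewrite (coord_vbasis (memvf X)) big1 // => i _.
  by have /negPn/eqP := X0 i; rewrite /x => ->; rewrite scale0r.
exists [ffun Z => if Z \in m then t / x i X * x i Z else 0].
  apply/dualP; split=> [c Y Z mY mZ | Y mY]; rewrite !ffunE ?(negPf mY) //.
  have x_lin : x i (c *: Y + Z) = c * x i Y + x i Z by apply: linearP.
  by rewrite mY mZ subspP // x_lin mulrDr mulrCA.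
by rewrite ffunE mX divfK.
Qed.

Lemma sum_theta_dual_eq0 (m : {set n}) X : GRing.submod_closed m ->
  X \in m -> X != 0 -> \sum_(l in dual m) theta (l X) = 0.
Proof.
move=> m_sub mX X_neq0; have [t theta_t] := theta_nontrivial.
have [l0 dl0 l0X] := exists_dual t m_sub mX X_neq0.
apply: (@sum_quasi_invariant_eq0 _ _ _
  (fun l : {ffun n -> F} => [ffun Z => 1 * l0 Z + l Z]) _ (theta t)) => //.
- move=> l l' /ffunP eq_ll'; apply/ffunP=> Z.
  by have := eq_ll' Z; rewrite !ffunE => /addrI.
- by move=> l dl; apply: dual_comb.
- by move=> l dl; rewrite ffunE mul1r thetaD l0X.
Qed.

(** Summing theta (l X) over l in the dual and X in m, in both orders, leaves
    only X = 0 on one side and only l = 0 on the other. *)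
Lemma card_dual (m : {set n}) : GRing.submod_closed m -> #|dual m| = #|m|.
Proof.
move=> m_sub.
have: \sum_(X in m) \sum_(l in dual m) theta (l X) = #|dual m|%:R.
  rewrite (bigD1 0) ?subsp0 //= [X in _ + X]big1 ?addr0 => [|X /andP[]].
    rewrite (eq_bigr (fun=> 1)) ?sumr_const // => l dl.
    by rewrite (dual0 m_sub dl) theta0.
  exact: sum_theta_dual_eq0.
rewrite exchange_big /= (eq_bigr (fun l : {ffun n -> F} =>
  if l == [ffun=> 0] then #|m|%:R else 0)).
  rewrite -big_mkcondr (big_pred1 [ffun=> 0]) => [/eqP|l].
    by rewrite eqr_nat => /eqP.
  by rewrite andb_idl // => /eqP->; apply: dual_zero.
move=> l dl; rewrite -sum_theta_functionals ?dual_zero //.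
by apply: eq_bigr => X _; rewrite ffunE oppr0 theta0 mulr1.
Qed.

Lemma sum_theta_dual (m : {set n}) X : GRing.submod_closed m -> X \in m ->
  \sum_(l in dual m) theta (l X) = if X == 0 then #|m|%:R else 0.
Proof.
move=> m_sub mX; case: eqP => [-> | /eqP]; last exact: sum_theta_dual_eq0.
rewrite (eq_bigr (fun=> 1)) ?sumr_const ?card_dual // => l dl.
by rewrite (dual0 m_sub dl) theta0.
Qed.

(** The indicator of the set of extensions of mu is the average over Y in k of
    theta (l Y - mu Y); exchanging the sums isolates Y = - X. *)
Lemma sum_theta_extensions (k : {set n}) (mu : {ffun n -> F}) X :
    GRing.submod_closed k -> mu \in dual k ->
  \sum_(l in dual [set: n] | restrict l k == mu) theta (l X)
    = #|[set: n]|%:R / #|k|%:R * (if X \in k then theta (mu X) else 0).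
Proof.
move=> k_sub dmu.
have T_sub := subspT n.
have k_neq0 : #|k|%:R != 0 :> C.
  by rewrite pnatr_eq0 -lt0n; apply/card_gt0P; exists 0; apply: subsp0.
apply: (mulfI k_neq0); rewrite [RHS]mulrA [_ * (_ / _)]mulrC divfK //.
transitivity (\sum_(l in dual [set: n])
    \sum_(Y in k) theta (l (X + Y)) * theta (- mu Y)).
  rewrite big_mkcondr mulr_sumr; apply: eq_bigr => l dl.
  rewrite (_ : (if _ then _ else _) =
    theta (l X) * (if restrict l k == mu then 1 else 0)); last first.
    by case: ifP; rewrite ?mulr1 ?mulr0.
  rewrite mulrCA [#|k|%:R * _](_ : _ =
    \sum_(Y in k) theta (restrict l k Y) * theta (- mu Y)); last first.
    rewrite sum_theta_functionals ?(restrict_dual k_sub (subsetT _) dl) //.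
    by case: ifP; rewrite ?mulr1 ?mulr0.
  rewrite mulr_sumr; apply: eq_bigr => Y kY.
  by rewrite (dualD dl) ?in_setT // thetaD restrictE // mulrA.
rewrite exchange_big /=.
under eq_bigr => Y kY do rewrite -mulr_suml sum_theta_dual ?inE // addr_eq0.
case: ifP => [kX | kX].
  rewrite (bigD1 (- X)) ?subspN //= opprK eqxx (dualN k_sub) // opprK.
  rewrite big1 ?addr0 // => Y /andP[_].
  by rewrite -eqr_oppLR eq_sym => /negPf ->; rewrite mul0r.
rewrite mulr0 big1 // => Y kY; case: eqP => [XY | _]; last by rewrite mul0r.
by rewrite XY subspN in kX.
Qed.

(** At X = 0 the sum over the extensions counts them, and the count
    #|n| / #|k| is nonzero. *)
Lemma exists_extension (k : {set n}) mu : GRing.submod_closed k ->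
  mu \in dual k -> exists2 l, l \in dual [set: n] & restrict l k = mu.
Proof.
move=> k_sub dmu.
have := sum_theta_extensions 0 k_sub dmu.
rewrite subsp0 // (dual0 k_sub) // theta0 mulr1.
have [l /andP[dl /eqP] | no_ext] := pickP
  (fun l => (l \in dual [set: n]) && (restrict l k == mu)); first by exists l.
rewrite big_pred0 // => /esym/eqP.
have card_neq0 (m : {set n}) : 0 \in m -> #|m| != 0%N.
  by move=> m0; rewrite -lt0n; apply/card_gt0P; exists 0.
by rewrite mulf_eq0 invr_eq0 !pnatr_eq0 !(negPf (card_neq0 _ _)) ?inE ?subsp0.
Qed.

(** Were f outside W, every w - f would be a nonzero functional, so the sum of
    theta (w X - f X) over w in W and X in n would vanish; but the sum over w
    is zero off the common kernel of W, where f vanishes, and 0 lies in it. *)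
Lemma mem_double_annihilator (W : {set {ffun n -> F}}) f :
    W \subset dual [set: n] -> [ffun=> 0] \in W ->
    (forall c, {in W &, forall l l', [ffun X => c * l X + l' X] \in W}) ->
    f \in dual [set: n] ->
    (forall X, {in W, forall w : {ffun n -> F}, w X = 0} -> f X = 0) ->
  f \in W.
Proof.
move=> /subsetP W_dual W0 W_lin df f0; apply: contraT => fW.
have T_sub := subspT n.
have: \sum_(X : n) \sum_(w in W) theta (w X) * theta (- f X) = 0.
  rewrite exchange_big /= big1 // => w Ww.
  rewrite (eq_bigl [in [set: n]]) => [|X]; last by rewrite inE.
  rewrite (sum_theta_functionals T_sub (W_dual w Ww) df); case: eqP => // w_f.
  by rewrite -w_f Ww in fW.
have W_kernel X : \sum_(w in W) theta (w X) * theta (- f X) =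
    if [forall w in W, w X == 0] then #|W|%:R else 0.
  case: ifPn => [/forall_inP X0 | ].
    rewrite (eq_bigr (fun=> 1)) ?sumr_const // => w Ww.
    rewrite (eqP (X0 w Ww)) f0 => [|w' Ww']; last exact/eqP/X0.
    by rewrite oppr0 theta0 mulr1.
  rewrite negb_forall_in => /exists_inP[w0 Ww0 w0X]; rewrite -mulr_suml.
  have [t theta_t] := theta_nontrivial.
  rewrite (@sum_quasi_invariant_eq0 _ _ _ (fun w : {ffun n -> F} =>
     [ffun Z => t / w0 X * w0 Z + w Z]) _ (theta t)) ?mul0r //.
  - move=> l l' /ffunP eq_ll'; apply/ffunP=> Z.
    by have := eq_ll' Z; rewrite !ffunE => /addrI.
  - by move=> w Ww; apply: W_lin.
  - by move=> w Ww; rewrite ffunE divfK // thetaD.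
under eq_bigr do rewrite W_kernel.
have W_gt0 : (0 < #|W|)%N by apply/card_gt0P; exists [ffun=> 0].
have K_gt0 : (0 < #|[pred X : n | [forall w in W, w X == 0%R]]|)%N.
  apply/card_gt0P; exists 0; apply/forall_inP=> w /W_dual dw.
  by rewrite (dual0 T_sub dw).
rewrite -big_mkcond /= sumr_const => /eqP.
by rewrite mulrn_eq0 pnatr_eq0 !eqn0Ngt K_gt0 W_gt0.
Qed.

End Duality.

(** * Supercharacters of a subalgebra *)

Section Orbits.
Variables (F : finFieldType) (n : nilAlgType F) (m : {set n}).
Hypothesis m_alg : subalgebra m.
Implicit Types (X Y : n) (l mu : {ffun n -> F}) (g h : algU n).

Lemma dual_act_orbit l g h :
  g \in alg_group m -> h \in alg_group m -> dual_act g l h \in dual_orbit m l.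
Proof. exact: imset2_f. Qed.

Lemma dual_orbit_refl l : l \in dual_orbit m l.
Proof. by rewrite -{1}[l]dual_act1 dual_act_orbit ?alg_group1. Qed.

Lemma dual_orbit_eq l mu :
  mu \in dual_orbit m l -> dual_orbit m mu = dual_orbit m l.
Proof.
have sub l1 l2 :
    l1 \in dual_orbit m l2 -> dual_orbit m l1 \subset dual_orbit m l2.
  case/imset2P=> g h Ug Uh ->; apply/subsetP=> _ /imset2P[g' h' Ug' Uh' ->].
  by rewrite dual_actM dual_act_orbit ?alg_groupM.
move=> mu_l; apply/eqP; rewrite eqEsubset sub //=; apply: sub.
case/imset2P: mu_l => g h Ug Uh ->.
by rewrite -{1}(dual_actK g l h) dual_act_orbit ?alg_groupV.
Qed.

Lemma dual_orbit_sym l mu :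
  mu \in dual_orbit m l -> l \in dual_orbit m mu.
Proof. by move/dual_orbit_eq->; apply: dual_orbit_refl. Qed.

Lemma dual_orbit_dual l : l \in dual m -> dual_orbit m l \subset dual m.
Proof.
move=> dl; apply/subsetP=> _ /imset2P[g h Ug Uh ->].
apply: dual_act_dual => // X; by rewrite biact_mem ?alg_groupV.
Qed.

Lemma dual_lorbit_refl l : l \in dual_lorbit m l.
Proof. by apply/imsetP; exists 1%g; rewrite ?alg_group1 ?dual_act1. Qed.

(** Right translation by h carries the left orbit of l to that of g l h. *)
Lemma card_dual_lorbit l mu :
  mu \in dual_orbit m l -> #|dual_lorbit m mu| = #|dual_lorbit m l|.
Proof.
case/imset2P=> g h Ug Uh ->.
rewrite -(card_imset (dual_lorbit m l) (@dual_act_inj F n 1%g h)).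
apply: eq_card => nu.
apply/imsetP/imsetP => [[x Ux ->] | [_ /imsetP[x Ux ->] ->]].
  exists (dual_act (x * g)%g l 1%g); last by rewrite !dual_actM !mul1g !mulg1.
  by apply/imsetP; exists (x * g)%g; rewrite ?alg_groupM.
exists (x * g^-1)%g; first by rewrite alg_groupM ?alg_groupV.
by rewrite !dual_actM !mul1g !mulg1 mulgKV.
Qed.

End Orbits.

(** Supercharacters form a finite subset of an infinite type; this passes from
    sums over such a set to sums over the functionals that index it. *)
Lemma sum_fset_fibers (V : nmodType) (T : finType) (K : choiceType)
    (Q : {fset K}) (A : {set T}) (f : T -> K) (F : T -> V) :
  \sum_(k <- Q) \sum_(x in A | f x == k) F x = \sum_(x in A | f x \in Q) F x.
Proof.
under eq_bigr do rewrite big_mkcondr.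
rewrite exchange_big [RHS]big_mkcondr; apply: eq_bigr => x _ /=.
case: ifP => Qx.
  rewrite (bigD1_seq (f x)) ?fset_uniq //= eqxx big1 ?addr0 // => k.
  by rewrite eq_sym => /negPf ->.
by rewrite big_seq big1 // => k Qk; case: eqP => // eq_k; rewrite eq_k Qk in Qx.
Qed.

Section Supercharacters.
Variables (F : finFieldType) (n : nilAlgType F) (C : numClosedFieldType).
Variable theta : F -> C.
Hypothesis theta_char : additive_character theta.
Hypothesis theta_nontrivial : exists t, theta t != 1.
Variable m : {set n}.
Hypothesis m_alg : subalgebra m.
Implicit Types (X Y : n) (l mu : {ffun n -> F}) (g h : algU n).
Local Notation U := (alg_group m).
Let m_sub := subalg_sub m_alg.

Definition orbit_sum l g : C :=
  \sum_(mu in dual_orbit m l) theta (mu (minus1 g)).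

(** Fourier inversion: the functions X |-> theta (mu X) are orthogonal, so a
    sum of some of them remembers which ones occur. *)
Lemma sum_theta_coefficient (B : {set {ffun n -> F}}) l :
    B \subset dual m -> l \in dual m ->
  \sum_(X in m) (\sum_(mu in B) theta (mu X)) * theta (- l X)
    = if l \in B then #|m|%:R else 0.
Proof.
move=> /subsetP B_dual dl; under eq_bigr do rewrite mulr_suml.
rewrite exchange_big /=.
under eq_bigr => mu Bmu do
  rewrite (sum_theta_functionals theta_char theta_nontrivial m_sub
    (B_dual _ Bmu) dl).
rewrite -big_mkcondr /=; case: ifP => Bl.
  by rewrite (big_pred1 l) // => mu; rewrite /= andb_idl // => /eqP->.
rewrite big_pred0 // => mu; apply/andP=> -[Bmu /eqP eq_mu].
by rewrite -eq_mu Bmu in Bl.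
Qed.

Lemma sum_biact_orbit l mu Z : mu \in dual_orbit m l ->
  \sum_(x in U) \sum_(y in U) theta (mu (biact x Z y))
  = \sum_(x in U) \sum_(y in U) theta (l (biact x Z y)).
Proof.
case/imset2P=> p q Up Uq ->; rewrite (reindex_inj (mulgI p)) /=.
apply: eq_big => [x | x _]; first exact: (@groupMl _ (alg_group_group m_alg)).
rewrite (reindex_inj (mulIg q)) /=.
apply: eq_big => [y | y _]; first exact: (@groupMr _ (alg_group_group m_alg)).
by rewrite dual_actE biactM mulKg mulgK.
Qed.

(** The double sum of theta (l (x Z y)) is the same for all members of the
    orbit of l, and for fixed x and y the orbit is merely permuted. *)
Lemma orbit_average l Z :
  #|dual_orbit m l|%:R * \sum_(x in U) \sum_(y in U) theta (l (biact x Z y))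
  = #|m|%:R ^+ 2 * \sum_(mu in dual_orbit m l) theta (mu Z).
Proof.
transitivity (\sum_(mu in dual_orbit m l)
    \sum_(x in U) \sum_(y in U) theta (mu (biact x Z y))).
  rewrite (eq_bigr _ (fun mu mu_l => sum_biact_orbit Z mu_l)) sumr_const.
  by rewrite mulr_natl.
rewrite exchange_big /=.
transitivity (\sum_(x in U) \sum_(y in U)
    \sum_(mu in dual_orbit m l) theta (mu Z)).
  apply: eq_bigr => x Ux; rewrite exchange_big /=; apply: eq_bigr => y Uy.
  rewrite (reindex_inj (@dual_act_inj F n x y)) /=.
  apply: eq_big => [mu | mu _]; last by rewrite dual_actE biactK.
  apply/idP/idP => [act_l | mu_l].
    rewrite -(dual_actK x mu y) -(dual_orbit_eq m_alg act_l).
    by rewrite dual_act_orbit ?alg_groupV.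
  by rewrite -(dual_orbit_eq m_alg mu_l) dual_act_orbit.
by rewrite !sumr_const card_alg_group -mulrnA -[LHS]mulr_natl natrM -expr2.
Qed.

Lemma card_m_neq0 : #|m|%:R != 0 :> C.
Proof.
by rewrite pnatr_eq0 -lt0n; apply/card_gt0P; exists 0; apply: subsp0.
Qed.

Lemma orbit_sum_inj l l' : l \in dual m -> l' \in dual m ->
  {in U, orbit_sum l =1 orbit_sum l'} -> l \in dual_orbit m l'.
Proof.
move=> dl dl' eq_sum; apply: contraTT isT => l_notin.
have := sum_theta_coefficient (dual_orbit_dual m_alg dl') dl.
rewrite (negPf l_notin).
have := sum_theta_coefficient (dual_orbit_dual m_alg dl) dl.
rewrite dual_orbit_refl //.
rewrite (eq_bigr (fun X => orbit_sum l' (OnePlus X) * theta (- l X)))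
  => [-> /eqP | X mX].
  by rewrite (negPf card_m_neq0).
by rewrite -eq_sum // mem_alg_group.
Qed.

Lemma sum_alg_group (f : algU n -> C) :
  \sum_(g in U) f g = \sum_(X in m) f (OnePlus X).
Proof. by rewrite big_imset // => X Y _ _; apply: OnePlus_inj. Qed.

Lemma card_orbit_neq0 l : #|dual_orbit m l|%:R != 0 :> C.
Proof.
rewrite pnatr_eq0 -lt0n; apply/card_gt0P; exists l; exact: dual_orbit_refl.
Qed.

Lemma card_lorbit_neq0 l : #|dual_lorbit m l|%:R != 0 :> C.
Proof.
rewrite pnatr_eq0 -lt0n; apply/card_gt0P; exists l; exact: dual_lorbit_refl.
Qed.

Lemma orbit_sum1 l : l \in dual m -> orbit_sum l 1%g = #|dual_orbit m l|%:R.
Proof.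
move=> dl; rewrite /orbit_sum (eq_bigr (fun=> 1)) ?sumr_const // => mu mu_l.
by rewrite (dual0 m_sub (subsetP (dual_orbit_dual m_alg dl) _ mu_l)) theta0.
Qed.

Lemma supercharacterE l g : supercharacter theta m l g =
  if g \in U then #|dual_lorbit m l|%:R / #|dual_orbit m l|%:R * orbit_sum l g
  else 0.
Proof. by rewrite ffunE. Qed.

Lemma inner_prod_supercharacter l : l \in dual m ->
  inner_prod U (supercharacter theta m l) (supercharacter theta m l)
  = (#|dual_lorbit m l|%:R / #|dual_orbit m l|%:R) ^+ 2 * #|dual_orbit m l|%:R.
Proof.
move=> dl; rewrite /inner_prod card_alg_group; apply: (mulfI card_m_neq0).
rewrite mulrA mulfV ?card_m_neq0 // mul1r.
set c := _ / _.
rewrite sum_alg_group (eq_bigr (fun X => \sum_(nu in dual_orbit m l)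
    c ^+ 2 * ((\sum_(mu in dual_orbit m l) theta (mu X)) * theta (- nu X)))).
  rewrite exchange_big /= (eq_bigr (fun=> c ^+ 2 * #|m|%:R)) => [|nu nu_l].
    by rewrite sumr_const -[LHS]mulr_natr mulrAC mulrC.
  rewrite -mulr_sumr sum_theta_coefficient ?dual_orbit_dual //.
    by rewrite nu_l.
  exact: (subsetP (dual_orbit_dual m_alg dl)).
move=> X mX; rewrite !supercharacterE mem_alg_group mX.
rewrite -[_ / _]/c rmorphM /= [c^*](_ : _ = c); last first.
  by rewrite /c rmorphM fmorphV !rmorph_nat.
rewrite /orbit_sum rmorph_sum /= mulrACA -mulr_sumr -mulr_sumr expr2.
congr (_ * (_ * _)); apply: eq_bigr => nu _; exact: theta_conj.
Qed.

Lemma multiplicity_supercharacter l : l \in dual m ->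
  multiplicity U (supercharacter theta m l)
  = #|dual_orbit m l|%:R / #|dual_lorbit m l|%:R.
Proof.
move=> dl; rewrite /multiplicity inner_prod_supercharacter // supercharacterE.
rewrite alg_group1 // orbit_sum1 //.
rewrite -mulf_div expr2.
have := card_orbit_neq0 l; have := card_lorbit_neq0 l.
set p := #|_|%:R; set q := #|_|%:R => p0 q0.
rewrite mulfV ?mulr1 // invfM mulrA mulfV ?mul1r ?invf_div //.
by rewrite mulf_neq0 ?invr_eq0.
Qed.

(** The two normalisations cancel, leaving the plain sum over the orbit. *)
Lemma multiplicity_mul_supercharacter l g : l \in dual m ->
  multiplicity U (supercharacter theta m l) * supercharacter theta m l g
  = if g \in U then orbit_sum l g else 0.
Proof.
move=> dl; rewrite multiplicity_supercharacter // supercharacterE.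
case: ifP => _; last by rewrite mulr0.
rewrite mulrA mulf_div [X in X / _]mulrC.
by rewrite mulfV ?mul1r ?mulf_neq0 ?card_orbit_neq0 ?card_lorbit_neq0.
Qed.

(** Members of one two-sided orbit have left orbits of equal size, hence equal
    normalising constants; conversely multiplying by the multiplicity gives
    the orbit sum, which determines the orbit. *)
Lemma supercharacter_eqP l l' : l \in dual m -> l' \in dual m ->
  reflect (supercharacter theta m l = supercharacter theta m l')
    (l \in dual_orbit m l').
Proof.
move=> dl dl'; apply: (iffP idP) => [l_l' | eq_chi].
  apply/ffunP=> g; rewrite !supercharacterE /orbit_sum.
  by rewrite (dual_orbit_eq m_alg l_l') (card_dual_lorbit m_alg l_l').
apply: orbit_sum_inj => // g Ug.
have := multiplicity_mul_supercharacter g dl; rewrite Ug => <-.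
by have := multiplicity_mul_supercharacter g dl'; rewrite Ug eq_chi => <-.
Qed.

Lemma supercharactersP chi : reflect
  (exists2 l, l \in dual m & chi = supercharacter theta m l)
  (chi \in supercharacters theta m).
Proof. exact: imfsetP. Qed.

Lemma sum_multiplicity_supercharacters (Q : {fset {ffun algU n -> C}}) g :
    {subset Q <= supercharacters theta m} ->
  \sum_(chi <- Q) multiplicity U chi * chi g
  = if g \in U then
      \sum_(l in dual m | supercharacter theta m l \in Q) theta (l (minus1 g))
    else 0.
Proof.
move=> Q_sub; transitivity (\sum_(chi <- Q) if g \in U then
    \sum_(l in dual m | supercharacter theta m l == chi) theta (l (minus1 g))
  else 0).
  rewrite !big_seq; apply: eq_bigr => chi /Q_sub/supercharactersP[l0 dl0 ->].
  rewrite multiplicity_mul_supercharacter //; case: ifP => // _.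
  apply: eq_bigl => l; apply/idP/andP=> [l_l0 | [dl /eqP eq_chi]].
    have dl := subsetP (dual_orbit_dual m_alg dl0) _ l_l0.
    by split=> //; apply/eqP/supercharacter_eqP.
  exact/supercharacter_eqP.
by case: ifP => _; [apply: sum_fset_fibers | apply: big1_eq].
Qed.

Lemma sum_multiplicity_regular g :
  \sum_(chi <- supercharacters theta m) multiplicity U chi * chi g
  = regular_character C U g.
Proof.
rewrite sum_multiplicity_supercharacters // ffunE card_alg_group.
rewrite (eq_bigl [in dual m]) => [|l]; last first.
  by apply: andb_idr => dl; apply/supercharactersP; exists l.
case: ifP => [| Ug]; last by case: eqP Ug => // ->; rewrite alg_group1.
by rewrite mem_alg_group => mg; rewrite sum_theta_dual.
Qed.

End Supercharacters.

(** * Semidirect products with a square-zero ideal *)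

Section SemidirectProduct.
Variables (F : finFieldType) (n : nilAlgType F) (C : numClosedFieldType).
Variable theta : F -> C.
Hypothesis theta_char : additive_character theta.
Hypothesis theta_nontrivial : exists t, theta t != 1.
Variables h a : {set n}.
Hypotheses (h_alg : subalgebra h) (a_alg : subalgebra a).
Hypothesis Un_semidirect :
  (alg_group a ><| alg_group h)%g = alg_group [set: n].
Hypothesis Ua_supernormal : supernormal (alg_group a).
Hypothesis a_square_zero : {in a &, forall X Y, nmul X Y = 0}.
Local Notation Ua := (alg_group a).
Local Notation Uh := (alg_group h).
Let h_sub := subalg_sub h_alg.
Let a_sub := subalg_sub a_alg.
Implicit Types (X Y Z : n) (l mu nu : {ffun n -> F}) (g x y : algU n).

(** Superclasses are orbits of the two-sided action, so supernormality says
    exactly that this action preserves a. *)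
Lemma biact_ideal g X y : (biact g X y \in a) = (X \in a).
Proof.
have stab x Y z : Y \in a -> biact x Y z \in a.
  have [K defUa] := Ua_supernormal.
  have UaE Z : (Z \in a) = (OnePlus Z \in \bigcup_(g in K) superclass g).
    by rewrite -defUa mem_alg_group.
  rewrite !UaE => /bigcupP[g0 Kg0 /imset2P[x1 z1 _ _ [->]]].
  by apply/bigcupP; exists g0; rewrite // biactM; apply: imset2_f.
by apply/idP/idP=> [/(stab g^-1%g _ y^-1%g) | /stab //]; rewrite biactK.
Qed.

Lemma idealMl X Y : Y \in a -> nmul X Y \in a.
Proof. by move=> aY; rewrite nmul_lact subspB ?biact_ideal. Qed.

Lemma idealMr X Y : X \in a -> nmul X Y \in a.
Proof. by move=> aX; rewrite nmul_ract subspB ?biact_ideal. Qed.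

Lemma biact_trivial g X y : g \in Ua -> y \in Ua -> X \in a -> biact g X y = X.
Proof.
rewrite !mem_alg_group => ag ay aX.
by rewrite biactE !(a_square_zero ag aX, a_square_zero aX ay) nmul0x !addr0.
Qed.

Lemma semidirect_factors : (Ua * Uh)%g = [set: algU n] /\ Ua :&: Uh = 1%g.
Proof.
have semi : (Ua ><| Uh)%g = [set: algU n]%G by rewrite Un_semidirect alg_groupT.
by case/sdprodP: semi.
Qed.

Lemma alg_group_factor g : exists x y, [/\ x \in Ua, y \in Uh & g = (x * y)%g].
Proof.
have [defU _] := semidirect_factors.
have : g \in (Ua * Uh)%g by rewrite defU inE.
by case/mulsgP=> x y Ux Uy ->; exists x, y.
Qed.

Lemma ideal_cap X : X \in a -> X \in h -> X = 0.
Proof.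
have [_ ti] := semidirect_factors; move=> aX hX.
suff : OnePlus X = 1%g by case.
by apply/set1gP; rewrite -ti inE !mem_alg_group aX hX.
Qed.

Lemma ideal_decomposition X : exists2 H, H \in h & X - H \in a.
Proof.
have [x [y []]] := alg_group_factor (OnePlus X).
rewrite !mem_alg_group => ax hy [->]; exists (minus1 y) => //.
by rewrite addrAC addrK subspD ?idealMr.
Qed.

(** The projection of n onto h along a, read off the decomposition n = h + a
    by choosing the unique suitable H. *)
Definition proj_h X : n := odflt 0 [pick H in h | X - H \in a].

Lemma proj_h_mem X : proj_h X \in h.
Proof.
by rewrite /proj_h; case: pickP => [H /andP[] // | _]; rewrite subsp0.
Qed.

Lemma proj_h_sub X : X - proj_h X \in a.
Proof.
rewrite /proj_h; case: pickP => [H /andP[] // | no].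
by have [H hH aXH] := ideal_decomposition X; have := no H; rewrite hH aXH.
Qed.

Lemma proj_h_unique X H : H \in h -> X - H \in a -> proj_h X = H.
Proof.
move=> hH aXH; apply/eqP; rewrite -subr_eq0; apply/eqP; apply: ideal_cap.
  have -> : proj_h X - H = (X - H) - (X - proj_h X).
    by rewrite opprB [RHS]addrC subrKA.
  by rewrite subspB ?proj_h_sub.
by rewrite subspB ?proj_h_mem.
Qed.

Lemma proj_h_lin c X Y : proj_h (c *: X + Y) = c *: proj_h X + proj_h Y.
Proof.
apply: proj_h_unique; first by rewrite subspP ?proj_h_mem.
by rewrite opprD addrACA -scalerBr subspP ?proj_h_sub.
Qed.

(** Extend mu to n, compose with the projection to h, and add nu composed with
    the projection to a; the two terms live on complementary summands. *)
Lemma exists_common_extension (s : {set n}) mu nu :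
    GRing.submod_closed s -> s \subset h -> mu \in dual s -> nu \in dual a ->
  exists l, [/\ l \in dual [set: n], restrict l s = mu & restrict l a = nu].
Proof.
move=> s_sub /subsetP sh dmu dnu.
have [l1 dl1 l1_s] := exists_extension theta_char theta_nontrivial s_sub dmu.
have T_sub := subspT n.
exists [ffun X => l1 (proj_h X) + nu (X - proj_h X)]; split.
- apply/dualP; split=> [c X Y _ _ | X]; last by rewrite inE.
  rewrite !ffunE proj_h_lin (dual_lin dl1) ?inE //.
  rewrite opprD addrACA -scalerBr (dual_lin dnu) ?proj_h_sub //.
  by rewrite mulrDr addrACA.
- rewrite -l1_s; apply/ffunP=> X; rewrite !ffunE; case: ifP => // sX.
  rewrite (proj_h_unique (H := X)) ?sh ?subrr ?subsp0 //.
  by rewrite (dual0 a_sub dnu) addr0.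
- apply/ffunP=> X; rewrite !ffunE; case: ifPn => [aX | aX]; last first.
    by rewrite (dual_out dnu).
  rewrite (proj_h_unique (H := 0)) ?subsp0 ?subr0 //.
  by rewrite (dual0 T_sub dl1) add0r.
Qed.

Lemma restrict_dual_act (m : {set n}) l g y :
    (forall X, (biact g^-1%g X y^-1%g \in m) = (X \in m)) ->
  restrict (dual_act g l y) m = dual_act g (restrict l m) y.
Proof. by move=> stab; apply/ffunP=> X; rewrite !ffunE stab. Qed.

Lemma restrict_ideal_act l g y :
  restrict (dual_act g l y) a = dual_act g (restrict l a) y.
Proof. by apply: restrict_dual_act => X; apply: biact_ideal. Qed.

Lemma dual_act_ideal nu g y : nu \in dual a -> dual_act g nu y \in dual a.
Proof. by move=> dnu; apply: dual_act_dual => // X; apply: biact_ideal. Qed.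

Lemma dual_actT l g y : l \in dual [set: n] -> dual_act g l y \in dual [set: n].
Proof. by move=> dl; apply: dual_act_dual => // X; rewrite !inE. Qed.

Lemma dual_act_trivial nu g y :
  nu \in dual a -> g \in Ua -> y \in Ua -> dual_act g nu y = nu.
Proof.
move=> dnu Ug Uy; apply: (dual_eq (dual_act_ideal _ _ dnu) dnu) => X aX.
by rewrite dual_actE biact_trivial ?alg_groupV.
Qed.

(** * Characters of the square-zero ideal and their stabilizers *)

Local Notation tau := (supercharacter theta a).

Lemma dual_orbit_ideal nu : nu \in dual a -> dual_orbit a nu = [set nu].
Proof.
move=> dnu; apply/setP=> l; rewrite inE; apply/idP/eqP => [|->].
  by case/imset2P=> g y Ug Uy ->; apply: dual_act_trivial.
exact: dual_orbit_refl.
Qed.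

Lemma ideal_characterE nu g : nu \in dual a ->
  tau nu g = if minus1 g \in a then theta (nu (minus1 g)) else 0.
Proof.
move=> dnu; rewrite supercharacterE mem_alg_group /orbit_sum.
rewrite dual_orbit_ideal // big_set1.
suff -> : dual_lorbit a nu = [set nu] by rewrite !cards1 divr1 mul1r.
apply/setP=> l; rewrite inE; apply/imsetP/eqP => [[x Ux ->] | ->].
  by rewrite dual_act_trivial ?alg_group1.
by exists 1%g; rewrite ?alg_group1 ?dual_act1.
Qed.

Lemma ideal_character_inj : {in dual a &, injective tau}.
Proof.
move=> nu nu' dnu dnu'.
move/(supercharacter_eqP theta_char theta_nontrivial a_alg dnu dnu').
by rewrite dual_orbit_ideal // inE => /eqP.
Qed.

Lemma char_act_ideal nu g y : nu \in dual a ->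
  char_act g (tau nu) y = tau (dual_act g nu y).
Proof.
move=> dnu; apply/ffunP=> u.
rewrite ffunE !ideal_characterE ?dual_act_ideal //=.
by rewrite biact_ideal dual_actE.
Qed.

Lemma char_act_fix nu g y : nu \in dual a ->
  (char_act g (tau nu) y == tau nu) = (dual_act g nu y == nu).
Proof.
move=> dnu; rewrite char_act_ideal //; apply/eqP/eqP => [|-> //].
by apply: ideal_character_inj; rewrite ?dual_act_ideal.
Qed.

Lemma char_orbitP nu sigma : nu \in dual a -> reflect
  (exists x y, [/\ x \in Uh, y \in Uh & sigma = tau (dual_act x nu y)])
  (sigma \in char_orbit Uh (tau nu)).
Proof.
move=> dnu; apply: (iffP (imfsetP _ _ _ _)) => [[[x y]] | [x [y [Ux Uy ->]]]].
  rewrite inE => /andP[/= Ux Uy] ->; exists x, y.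
  by rewrite char_act_ideal.
by exists (x, y); rewrite ?char_act_ideal // inE /= Ux.
Qed.

(** The radical of nu is the subspace a + s, where s is the algebra of the
    stabilizer of the character of U_a attached to nu. *)
Definition radical nu : {set n} :=
  [set X | [forall A in a, (nu (nmul A X) == 0) && (nu (nmul X A) == 0)]].

Lemma radicalP nu X : reflect
  ({in a, forall A, nu (nmul A X) = 0} /\ {in a, forall A, nu (nmul X A) = 0})
  (X \in radical nu).
Proof.
rewrite inE; apply: (iffP forall_inP) => [rad | [radl radr] A aA].
  by split=> A /rad/andP[/eqP ? /eqP ?].
by rewrite radl ?radr ?eqxx.
Qed.

Lemma ideal_sub_radical nu : nu \in dual a -> a \subset radical nu.
Proof.
move=> dnu; apply/subsetP=> X aX; apply/radicalP.
by split=> A aA; rewrite a_square_zero ?(dual0 a_sub).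
Qed.

Lemma radical_subalgebra nu : nu \in dual a -> subalgebra (radical nu).
Proof.
move=> dnu; split; first split.
- by apply/radicalP; split=> A _; rewrite ?nmulx0 ?nmul0x (dual0 a_sub).
- move=> c X Y /radicalP[Xl Xr] /radicalP[Yl Yr]; apply/radicalP; split=> A aA.
    by rewrite nmulDr nmulZr (dual_lin dnu) ?idealMr // Xl ?Yl // mulr0 addr0.
  by rewrite nmulDl nmulZl (dual_lin dnu) ?idealMl // Xr ?Yr // mulr0 addr0.
- move=> X Y /radicalP[Xl Xr] /radicalP[Yl Yr]; apply/radicalP; split=> A aA.
    by rewrite nmulA Yl ?idealMr.
  by rewrite -nmulA Xr ?idealMl.
Qed.

Lemma radical_cap_subalgebra nu :
  nu \in dual a -> subalgebra (radical nu :&: h).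
Proof.
move=> dnu; have rad_alg := radical_subalgebra dnu.
have rad_sub := subalg_sub rad_alg; split; first split.
- by rewrite inE !subsp0.
- by move=> c X Y /setIP[rX hX] /setIP[rY hY]; rewrite inE !subspP.
- by move=> X Y /setIP[rX hX] /setIP[rY hY]; rewrite inE !subalgM.
Qed.

(** The functional A |-> nu (g A) equals nu on a exactly when g - 1
    annihilates a under nu; lstabP and rstabP phrase the stabilizer conditions
    by products so that they become linear in g - 1. *)
Lemma lstabP nu g : nu \in dual a -> reflect
  {in a, forall A, nu (nmul (minus1 g) A) = 0} (dual_act g nu 1%g == nu).
Proof.
move=> dnu.
have actE A : A \in a -> nu (biact g A 1%g) = nu A + nu (nmul (minus1 g) A).
  move=> aA; rewrite biactE minus1_1 !nmulx0 !addr0 (dualD dnu) ?idealMl //.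
apply: (iffP eqP) => [fix_nu A aA | rad].
  apply: (addrI (nu A)); rewrite -actE // addr0 -{1}fix_nu dual_actE.
  by rewrite -[1%g in X in nu X]invg1 biactK.
apply: (dual_eq (dual_act_ideal _ _ dnu) dnu) => A aA.
have := actE (biact g^-1%g A 1%g^-1%g).
by rewrite biact_ideal biactVK rad ?biact_ideal // addr0 dual_actE => <-.
Qed.

Lemma rstabP nu g : nu \in dual a -> reflect
  {in a, forall A, nu (nmul A (minus1 g)) = 0} (dual_act 1%g nu g == nu).
Proof.
move=> dnu.
have actE A : A \in a -> nu (biact 1%g A g) = nu A + nu (nmul A (minus1 g)).
  move=> aA; rewrite biactE minus1_1 !nmul0x !addr0 (dualD dnu) ?idealMr //.
apply: (iffP eqP) => [fix_nu A aA | rad].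
  apply: (addrI (nu A)); rewrite -actE // addr0 -{1}fix_nu dual_actE.
  by rewrite -[1%g in X in nu X]invg1 biactK.
apply: (dual_eq (dual_act_ideal _ _ dnu) dnu) => A aA.
have := actE (biact 1%g^-1%g A g^-1%g).
by rewrite biact_ideal biactVK rad ?biact_ideal // addr0 dual_actE => <-.
Qed.

Lemma bistabE nu : nu \in dual a ->
  bistab Uh (tau nu) = alg_group (radical nu :&: h).
Proof.
move=> dnu; apply/setP=> g; rewrite mem_alg_group /bistab !in_setI.
rewrite [g \in lstab _ _]in_set [g \in rstab _ _]in_set.
rewrite !char_act_fix // mem_alg_group.
case: (minus1 g \in h) => //=; rewrite ?andbF // andbT.
apply/andP/radicalP => [[/lstabP lg /rstabP rg] | [rg lg]].
  by split=> A aA; [apply: rg | apply: lg].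
by split; [apply/lstabP | apply/rstabP].
Qed.

Lemma bistab_algE nu : nu \in dual a ->
  bistab_alg Uh (tau nu) = radical nu :&: h.
Proof.
move=> dnu; rewrite /bistab_alg bistabE //.
apply/setP=> X; apply/imsetP/idP => [[g] | sX].
  by rewrite mem_alg_group => sg ->.
by exists (OnePlus X); rewrite ?mem_alg_group.
Qed.

Lemma mem_tstab nu x y : nu \in dual a ->
  ((x, y) \in tstab Uh (tau nu))
  = [&& x \in Uh, y \in Uh & dual_act x nu y^-1%g == nu].
Proof. by move=> dnu; rewrite inE in_setX /= char_act_fix // andbA. Qed.

Lemma tstab_actE (gh : algU n * algU n) l :
  tstab_act gh l = dual_act gh.1 l gh.2^-1%g.
Proof. by apply/ffunP=> X; rewrite !ffunE invgK. Qed.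

Lemma dual_act_fixV nu x y :
  dual_act x nu y = nu -> dual_act x^-1%g nu y^-1%g = nu.
Proof. by move=> fix_nu; rewrite -{1}fix_nu dual_actK. Qed.

(** Invariance of nu lets x and y be moved around the pairing: for A in a,
    nu (A x^-1 X y^-1) = nu (x A x^-1 X), where x A x^-1 is again in a. *)
Lemma biact_radical nu x y X : nu \in dual a -> dual_act x nu y = nu ->
  (biact x^-1%g X y^-1%g \in radical nu) = (X \in radical nu).
Proof.
have stab u v Y : dual_act u nu v = nu -> Y \in radical nu ->
    biact u^-1%g Y v^-1%g \in radical nu.
  move=> fix_nu /radicalP[radl radr].
  have nuE Z : nu (biact u Z v) = nu Z.
    by rewrite -[in LHS]fix_nu dual_actE biactK.
  apply/radicalP; split=> A aA; rewrite -nuE biact_nmul biactM.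
    by rewrite mul1g mulVg -nmul_biact_mid radl // !biact_ideal.
  by rewrite mulgV mulg1 nmul_biact_mid radr // !biact_ideal.
move=> dnu fix_nu; apply/idP/idP => [|/stab->//].
by move/(stab _ _ _ (dual_act_fixV fix_nu)); rewrite biactK.
Qed.

Lemma biact_radical_cap nu x y X :
    nu \in dual a -> x \in Uh -> y \in Uh -> dual_act x nu y = nu ->
  (biact x^-1%g X y^-1%g \in radical nu :&: h) = (X \in radical nu :&: h).
Proof.
move=> dnu Ux Uy fix_nu.
by rewrite !in_setI biact_radical ?biact_mem ?alg_groupV.
Qed.

Lemma dual_act_stab nu x y : nu \in dual a ->
    x \in alg_group (radical nu :&: h) -> y \in alg_group (radical nu :&: h) ->
  dual_act x nu y = nu.
Proof.
move=> dnu; rewrite !mem_alg_group !in_setI.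
move=> /andP[/radicalP[_ radx] _] /andP[/radicalP[rady _] _].
have fix_x : dual_act x nu 1%g = nu by apply/eqP/lstabP.
have fix_y : dual_act 1%g nu y = nu by apply/eqP/rstabP.
by rewrite -[x]mul1g -[y]mul1g -dual_actM fix_x.
Qed.

(** * Orbits of functionals on the semidirect product *)

Lemma restrict_radicalP nu l l' : nu \in dual a ->
    l \in dual [set: n] -> l' \in dual [set: n] ->
    restrict l a = nu -> restrict l' a = nu ->
    restrict l (radical nu :&: h) = restrict l' (radical nu :&: h) ->
  {in radical nu, l =1 l'}.
Proof.
move=> dnu dl dl' l_a l'_a eq_s X rX.
have rad_sub := subalg_sub (radical_subalgebra dnu).
have aX := proj_h_sub X; rewrite -(subrK (proj_h X) X).
rewrite (dualD dl) ?in_setT // (dualD dl') ?in_setT //; congr (_ + _).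
  by rewrite -(restrictE l aX) l_a -l'_a restrictE.
have sX : proj_h X \in radical nu :&: h.
  rewrite in_setI proj_h_mem andbT.
  rewrite -[proj_h X](subKr X); apply: subspB => //.
  exact: (subsetP (ideal_sub_radical dnu)).
by rewrite -(restrictE l sX) eq_s restrictE.
Qed.

(** Acting on l by the inverses of 1 + A and 1 + B, for A and B in a, adds to it
    the functional X |-> l (A X + X B). These functionals form a linear space,
    whose common kernel is the radical; by duality they are all those that
    vanish there. *)
Lemma ideal_orbit nu l l' : nu \in dual a ->
    l \in dual [set: n] -> l' \in dual [set: n] ->
    restrict l a = nu -> restrict l' a = nu ->
    restrict l (radical nu :&: h) = restrict l' (radical nu :&: h) ->
  exists x y, [/\ x \in Ua, y \in Ua & l' = dual_act x l y].
Proof.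
move=> dnu dl dl' l_a l'_a eq_s.
have T_sub := subspT n.
(* X |-> l (A X + X B) vanishes on a because a squares to zero, so the
   members of W are compared with l' - l on all of n. *)
pose w A B : {ffun n -> F} := [ffun X => l (nmul A X) + l (nmul X B)].
pose W := [set w A B | A in a, B in a].
have l_nu A : A \in a -> l A = nu A by move=> aA; rewrite -l_a restrictE.
pose f : {ffun n -> F} := [ffun X => -1 * l X + l' X].
have : f \in W.
  apply: (mem_double_annihilator theta_char theta_nontrivial).
  - apply/subsetP=> _ /imset2P[A B aA aB ->].
    apply/dualP; split=> [c X Y _ _ | X]; last by rewrite inE.
    rewrite !ffunE nmulDr nmulDl nmulZl nmulZr.
    by rewrite !(dual_lin dl) ?inE // mulrDr addrACA.
  - apply/imset2P; exists 0 0; rewrite ?subsp0 //; apply/ffunP=> X.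
    by rewrite !ffunE nmulx0 nmul0x (dual0 T_sub dl) addr0.
  - move=> c _ _ /imset2P[A B aA aB ->] /imset2P[A' B' aA' aB' ->].
    apply/imset2P; exists (c *: A + A') (c *: B + B'); rewrite ?subspP //.
    apply/ffunP=> X; rewrite !ffunE nmulDr nmulDl nmulZl nmulZr.
    by rewrite !(dual_lin dl) ?inE // mulrDr addrACA.
  - exact: dual_comb.
  move=> X X_ker; rewrite ffunE (@restrict_radicalP nu l l') ?mulN1r ?addNr //.
  apply/radicalP; split=> A aA.
    have := X_ker (w A 0).
    rewrite ffunE nmulx0 (dual0 T_sub dl) addr0 l_nu ?idealMr //.
    by apply; apply: imset2_f => //; apply: subsp0.
  have := X_ker (w 0 A).
  rewrite ffunE nmul0x (dual0 T_sub dl) add0r l_nu ?idealMl //.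
  by apply; apply: imset2_f => //; apply: subsp0.
case/imset2P=> A B aA aB fE.
exists (OnePlus A)^-1%g, (OnePlus B)^-1%g.
split; rewrite ?alg_groupV ?mem_alg_group //.
apply/ffunP=> X; rewrite dual_actE !invgK biactE /=.
rewrite (a_square_zero (idealMr _ aA) aB) addr0.
rewrite !(dualD dl) ?inE // -addrA.
have /ffunP/(_ X) := fE; rewrite !ffunE => <-.
by rewrite mulN1r addrA subrr add0r.
Qed.

(** The U_a-parts of the factors in U_n act trivially on functionals on a,
    leaving the factors in U_h. *)
Lemma char_orbit_restrict l0 sigma : l0 \in dual [set: n] -> reflect
  (exists2 l, l \in dual_orbit [set: n] l0 & sigma = tau (restrict l a))
  (sigma \in char_orbit Uh (tau (restrict l0 a))).
Proof.
move=> dl0; have dnu : restrict l0 a \in dual a.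
  by apply: restrict_dual dl0; rewrite ?subsetT.
apply: (iffP (char_orbitP _ dnu)) => [[x [y [Ux Uy ->]]] | ].
  exists (dual_act x l0 y); last by rewrite restrict_ideal_act.
  by rewrite dual_act_orbit // mem_alg_group inE.
case=> _ /imset2P[x y _ _ ->] ->.
have [x1 [x2 [Ux1 Ux2 x_E]]] := alg_group_factor x.
have [y1 [y2 [Uy1 Uy2 y_E]]] := alg_group_factor y^-1%g.
have yE : y = (y2^-1 * y1^-1)%g by rewrite -invMg -y_E invgK.
exists x2, y2^-1%g; rewrite alg_groupV //; split=> //.
rewrite restrict_ideal_act x_E yE -dual_actM.
by rewrite dual_act_trivial ?alg_groupV ?dual_act_ideal.
Qed.

Section FixedCharacter.
Variable nu : {ffun n -> F}.
Hypothesis dnu : nu \in dual a.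
Local Notation s := (radical nu :&: h).
Let s_alg := radical_cap_subalgebra dnu.
Let s_sub := subalg_sub s_alg.
Let rad_alg := radical_subalgebra dnu.
Let rad_sub := subalg_sub rad_alg.
Local Notation chi_s := (supercharacter theta s).

Lemma restrict_s_dual l : l \in dual [set: n] -> restrict l s \in dual s.
Proof. by move=> dl; apply: restrict_dual dl; rewrite ?subsetT. Qed.

Lemma restrict_a_dual l : l \in dual [set: n] -> restrict l a \in dual a.
Proof. by move=> dl; apply: restrict_dual dl; rewrite ?subsetT. Qed.

Lemma restrict_s_act l x y : x \in Uh -> y \in Uh -> dual_act x nu y = nu ->
  restrict (dual_act x l y) s = dual_act x (restrict l s) y.
Proof.
move=> Ux Uy fix_nu; apply: restrict_dual_act => X.
exact: biact_radical_cap.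
Qed.

(** The functional X |-> nu (A X + X B) added by U_a vanishes on s, which lies
    in the radical of nu. *)
Lemma restrict_s_ideal_act l x y : l \in dual [set: n] -> restrict l a = nu ->
  x \in Ua -> y \in Ua -> restrict (dual_act x l y) s = restrict l s.
Proof.
move=> dl l_a Ux Uy; apply/ffunP=> X; rewrite !ffunE.
case: ifP => // /setIP[/radicalP[radl radr] _].
rewrite biactE !(dualD dl) ?inE //.
move: Ux Uy; rewrite -alg_groupV // -(@alg_groupV _ _ _ a_alg y) !mem_alg_group.
set A := minus1 _; set B := minus1 _ => aA aB.
have l_nu Z : Z \in a -> l Z = nu Z by move=> aZ; rewrite -l_a restrictE.
rewrite (a_square_zero (idealMr _ aA) aB) (dual0 (subspT n) dl) addr0.
rewrite (l_nu (nmul A X)) ?idealMr // (l_nu (nmul X B)) ?idealMl //.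
by rewrite radl ?radr // !addr0.
Qed.

(** An element of U_n is a product of one of U_a, which only moves l outside
    of a and s, and one of U_h, which must fix nu and then acts on the
    restriction to s. *)
Lemma tau_equiv_orbit l l' : l \in dual [set: n] -> l' \in dual [set: n] ->
    restrict l a = nu -> restrict l' a = nu ->
  tau_equiv theta Uh (tau nu) (chi_s (restrict l s)) (chi_s (restrict l' s))
    = (l \in dual_orbit [set: n] l').
Proof.
move=> dl dl' l_a l'_a; rewrite /tau_equiv bistab_algE //.
have Un x : x \in alg_group [set: n] by rewrite mem_alg_group inE.
have sUh x : x \in alg_group s -> x \in Uh.
  by rewrite !mem_alg_group in_setI => /andP[].
apply/exists_inP/idP => [[mu dmu /exists_inP[mu' dmu' /and3P[]]] | ].
  move=> /eqP/(supercharacter_eqP theta_char theta_nontrivial s_alg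
    (restrict_s_dual dl) dmu).
  case/imset2P=> p q sp sq eq_l.
  move=> /eqP/esym/(supercharacter_eqP theta_char theta_nontrivial s_alg dmu'
    (restrict_s_dual dl')).
  case/imset2P=> p' q' sp' sq' eq_l'.
  case/imsetP=> [[x y]]; rewrite mem_tstab // => /and3P[Ux Uy /eqP fix_xy].
  rewrite tstab_actE /= => eq_mu.
  (* (x', y'^-1) lies in T_tau since S_tau fixes nu on both sides *)
  pose x' := (p * x * p')%g; pose y' := (q' * (y^-1 * q))%g.
  have Ux' : x' \in Uh by rewrite !(alg_groupM h_alg) ?(sUh _ sp) ?(sUh _ sp').
  have Uy' : y' \in Uh
    by rewrite !(alg_groupM h_alg) ?alg_groupV ?(sUh _ sq) ?(sUh _ sq').
  have fix' : dual_act x' nu y' = nu.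
    rewrite -dual_actM (dual_act_stab dnu sp' sq').
    by rewrite -dual_actM fix_xy dual_act_stab.
  have eq_s : restrict (dual_act x' l' y') s = restrict l s.
    rewrite restrict_s_act // eq_l eq_mu eq_l' !dual_actM.
    by rewrite /x' /y' !mulgA.
  have [|u [v [_ _ ->]]] := ideal_orbit dnu (dual_actT x' y' dl') dl _ l_a eq_s.
    by rewrite restrict_ideal_act l'_a fix'.
  by rewrite dual_actM dual_act_orbit.
case/imset2P=> x y _ _ l_l'.
have [x1 [x2 [Ux1 Ux2 x_E]]] := alg_group_factor x.
have [y1 [y2 [Uy1 Uy2 y_E]]] := alg_group_factor y^-1%g.
have yE : y = (y2^-1 * y1^-1)%g by rewrite -invMg -y_E invgK.
pose l2 := dual_act x2 l' y2^-1%g.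
have l_l2 : l = dual_act x1 l2 y1^-1%g by rewrite dual_actM -x_E -yE.
have l2_a : restrict l2 a = nu.
  have dl2a : restrict l2 a \in dual a by rewrite restrict_a_dual ?dual_actT.
  rewrite -l_a l_l2 restrict_ideal_act dual_act_trivial ?alg_groupV //.
have fix2 : dual_act x2 nu y2^-1%g = nu by rewrite -{1}l'_a -restrict_ideal_act.
exists (restrict l s); first exact: restrict_s_dual.
apply/exists_inP; exists (restrict l' s); first exact: restrict_s_dual.
rewrite !eqxx /=; apply/imsetP; exists (x2, y2).
  by rewrite mem_tstab // Ux2 Uy2 fix2 /=.
rewrite tstab_actE /= -restrict_s_act ?alg_groupV // l_l2.
by rewrite restrict_s_ideal_act ?alg_groupV ?dual_actT.
Qed.

(** * Superinduction *)

Lemma alg_group_radical : (Ua * alg_group s)%g = alg_group (radical nu).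
Proof.
have /subsetP a_rad := ideal_sub_radical dnu.
apply/setP=> u; apply/mulsgP/idP => [[x y] | ru].
  rewrite !(mem_alg_group _ x, mem_alg_group _ y) in_setI => ax /andP[ry _] ->.
  by apply: alg_groupM; rewrite // mem_alg_group //; apply: a_rad.
have [x [y [Ux Uy u_E]]] := alg_group_factor u; exists x y => //.
have rx : x \in alg_group (radical nu).
  by rewrite mem_alg_group a_rad // -mem_alg_group.
rewrite mem_alg_group in_setI -!mem_alg_group Uy andbT.
by rewrite -(mulKg x y) -u_E alg_groupM ?alg_groupV.
Qed.

Local Notation fiber l0 :=
  [set l in dual_orbit [set: n] l0 | restrict l a == nu].
Local Notation cls l0 :=
  (tau_class theta Uh (tau nu) (chi_s (restrict l0 s))).

Lemma mem_tau_class l l0 : l \in dual [set: n] -> l0 \in dual [set: n] ->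
    restrict l a = nu -> restrict l0 a = nu ->
  (chi_s (restrict l s) \in cls l0) = (l \in dual_orbit [set: n] l0).
Proof.
move=> dl dl0 l_a l0_a; rewrite !inE /= bistab_algE //.
rewrite tau_equiv_orbit // andb_idl // => _.
by apply/supercharactersP; exists (restrict l s) => //; apply: restrict_s_dual.
Qed.

Lemma tau_class_sub psi :
  {subset tau_class theta Uh (tau nu) psi <= supercharacters theta s}.
Proof. by move=> phi; rewrite !inE /= bistab_algE // => /andP[]. Qed.

Lemma exists_functional_over mu : mu \in dual s -> exists l,
  [/\ l \in dual [set: n], restrict l s = mu & restrict l a = nu].
Proof. by move=> dmu; apply: exists_common_extension; rewrite ?subsetIr. Qed.

(** Every supercharacter of S_tau comes from a functional on n that restricts
    to nu, so a class is determined by the orbit of such functionals. *)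
Lemma tau_class_eqP l l0 : l \in dual [set: n] -> l0 \in dual [set: n] ->
    restrict l a = nu -> restrict l0 a = nu ->
  reflect (cls l = cls l0) (l \in dual_orbit [set: n] l0).
Proof.
move=> dl dl0 l_a l0_a; have Tn := subalgT n.
have sub l1 l2 : l1 \in dual [set: n] -> l2 \in dual [set: n] ->
    restrict l1 a = nu -> restrict l2 a = nu ->
    l1 \in dual_orbit [set: n] l2 -> {subset cls l1 <= cls l2}.
  move=> dl1 dl2 l1_a l2_a l12 phi phi_cls.
  have /supercharactersP[mu dmu phi_mu] := tau_class_sub phi_cls.
  have [k [dk k_s k_a]] := exists_functional_over dmu.
  rewrite phi_mu -k_s in phi_cls *.
  rewrite (mem_tau_class dk dl2 k_a l2_a) -(dual_orbit_eq Tn l12).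
  by rewrite (mem_tau_class dk dl1 k_a l1_a) in phi_cls.
apply: (iffP idP) => [l_l0 | eq_cls].
  apply/fsetP=> phi; apply/idP/idP; apply: sub => //.
  exact: dual_orbit_sym.
rewrite -(mem_tau_class dl dl0 l_a l0_a) -eq_cls.
by rewrite (mem_tau_class dl dl l_a l_a) dual_orbit_refl.
Qed.

Lemma theta_extension_factor l x y : l \in dual [set: n] -> restrict l a = nu ->
    x \in Ua -> y \in alg_group s ->
  theta (l (minus1 (x * y)%g))
    = theta (nu (minus1 x)) * theta (restrict l s (minus1 y)).
Proof.
move=> dl l_a; rewrite !mem_alg_group => ax.
move=> /[dup] sy /setIP[/radicalP[rady _] _].
have l_nu Z : Z \in a -> l Z = nu Z by move=> aZ; rewrite -l_a restrictE.
rewrite minus1M !(dualD dl) ?inE // l_nu // restrictE //.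
by rewrite (l_nu (nmul _ _)) ?idealMr // rady // addr0 thetaD.
Qed.

(** Sorting the functionals of the fibre by their restriction to s, each class
    consists of all extensions of one functional on the radical. *)
Lemma sum_fiber l0 Z : l0 \in dual [set: n] -> restrict l0 a = nu ->
  \sum_(l in fiber l0) theta (l Z) =
  #|[set: n]|%:R / #|radical nu|%:R *
  (if OnePlus Z \in (Ua * alg_group s)%g then
    theta (nu (minus1 (divgr Ua (alg_group s) (OnePlus Z)))) *
    \sum_(mu in dual s | chi_s mu \in cls l0)
       theta (mu (minus1 (remgr Ua (alg_group s) (OnePlus Z))))
   else 0).
Proof.
move=> dl0 l0_a.
have orb_dual := subsetP (dual_orbit_dual (subalgT n) dl0).
rewrite (partition_big (fun l => restrict l s)
  (fun mu => (mu \in dual s) && (chi_s mu \in cls l0))) /=; last first.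
  move=> l; rewrite in_set => /andP[l_l0 /eqP l_a].
  have dl := orb_dual _ l_l0.
  by rewrite restrict_s_dual // mem_tau_class.
rewrite (eq_bigr (fun mu => #|[set: n]|%:R / #|radical nu|%:R *
  (if OnePlus Z \in (Ua * alg_group s)%g then
    theta (nu (minus1 (divgr Ua (alg_group s) (OnePlus Z)))) *
    theta (mu (minus1 (remgr Ua (alg_group s) (OnePlus Z)))) else 0))).
  rewrite -mulr_sumr; congr (_ * _).
  by case: ifP => _; [rewrite mulr_sumr | rewrite big1_eq].
move=> mu /andP[dmu cls_mu].
have [l1 [dl1 l1_s l1_a]] := exists_functional_over dmu.
have l1_l0 : l1 \in dual_orbit [set: n] l0 by rewrite -mem_tau_class // l1_s.
have rad_dual l :
    l \in dual [set: n] -> restrict l (radical nu) \in dual (radical nu).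
  by move=> dl; apply: restrict_dual dl; rewrite ?subsetT.
rewrite (eq_bigl (fun l => (l \in dual [set: n]) &&
    (restrict l (radical nu) == restrict l1 (radical nu)))); last first.
  move=> l; rewrite in_set.
  apply/andP/andP => [[/andP[l_l0 /eqP l_a] /eqP l_s] | ].
    have dl := orb_dual _ l_l0; split=> //; apply/eqP/ffunP=> X; rewrite !ffunE.
    by case: ifP => // rX; rewrite (restrict_radicalP dnu dl dl1) ?l_s ?l1_s.
  case=> dl /eqP eq_rad.
  have eq_l X : X \in radical nu -> l X = l1 X.
    by move=> rX; rewrite -(restrictE l rX) eq_rad restrictE.
  have l_s : restrict l s = mu.
    rewrite -l1_s; apply/ffunP=> X; rewrite !ffunE.
    case: ifP => // /setIP[rX _].
    exact: eq_l.
  have l_a : restrict l a = nu.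
    rewrite -l1_a; apply/ffunP=> X; rewrite !ffunE; case: ifP => // aX.
    by rewrite eq_l // (subsetP (ideal_sub_radical dnu)).
  by rewrite -mem_tau_class // l_s l_a cls_mu !eqxx.
rewrite (sum_theta_extensions theta_char theta_nontrivial) ?rad_dual //.
congr (_ * _).
rewrite -[Z]/(minus1 (OnePlus Z)) -mem_alg_group -alg_group_radical.
rewrite -[OnePlus (minus1 _)]/(OnePlus Z).
case: ifP => // u_UaS.
have x_a := @mem_divgr _ (alg_group_group a_alg)
  (alg_group_group s_alg) _ u_UaS.
have y_s := @mem_remgr _ (alg_group_group a_alg) (alg_group s) _ u_UaS.
rewrite restrictE; last first.
  by rewrite -[Z]/(minus1 (OnePlus Z)) -mem_alg_group -alg_group_radical.
rewrite -l1_s -theta_extension_factor //.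
by rewrite -divgr_eq.
Qed.

(** The restriction to a maps the orbit of l0 onto the orbit of nu, and the
    two-sided action carries the fibre over nu to every other fibre. *)
Lemma card_char_orbit l0 : l0 \in dual [set: n] -> restrict l0 a = nu ->
  (#|` char_orbit Uh (tau nu)| * #|fiber l0|)%N = #|dual_orbit [set: n] l0|.
Proof.
move=> dl0 l0_a.
pose N := [set restrict l a | l in dual_orbit [set: n] l0].
have N_dual : {subset N <= dual a}.
  move=> _ /imsetP[l /(subsetP (dual_orbit_dual (subalgT n) dl0)) dl ->].
  exact: restrict_a_dual.
have -> : #|` char_orbit Uh (tau nu)| = #|N|.
  have -> : char_orbit Uh (tau nu) = [fset tau mu | mu in N]%fset.
    apply/fsetP=> sigma; rewrite -l0_a.
    apply/char_orbit_restrict/imfsetP => //= [[l l_l0 ->] | ].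
      by exists (restrict l a) => //; apply: imset_f.
    by case=> _ /imsetP[l l_l0 ->] ->; exists l.
  rewrite card_in_imfset -?cardE //= => mu mu' /N_dual dmu /N_dual dmu'.
  exact: ideal_character_inj.
rewrite -[RHS]sum1_card (partition_big_imset (fun l => restrict l a)) /= -/N.
rewrite (eq_bigr (fun=> #|fiber l0|)) ?sum_nat_const // => mu.
case/imsetP=> _ /imset2P[x y _ _ ->] ->; rewrite restrict_ideal_act l0_a.
rewrite sum1dep_card -(card_imset (fiber l0) (@dual_act_inj F n x y)).
apply: eq_card => l; rewrite !inE; apply/andP/imsetP.
  case=> l_l0 /eqP l_a; exists (dual_act x^-1%g l y^-1%g).
    rewrite in_set restrict_ideal_act l_a dual_actK eqxx andbT.
    rewrite -(dual_orbit_eq (subalgT n) l_l0) dual_act_orbit //;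
      by rewrite mem_alg_group inE.
  by rewrite dual_actM mulgV mulVg dual_act1.
case=> l2; rewrite in_set => /andP[l2_l0 /eqP l2_a] ->.
rewrite restrict_ideal_act l2_a eqxx; split=> //.
rewrite -(dual_orbit_eq (subalgT n) l2_l0) dual_act_orbit //;
  by rewrite mem_alg_group inE.
Qed.

(** By sum_fiber the function to be induced, extended by zero, is a multiple
    of the sum of theta o l over the fibre of l0; averaging over both sides
    turns each term into the same multiple of the orbit sum. The resulting
    factor #|O| * #|fiber| / #|orbit| is 1 by card_char_orbit. *)
Lemma SInd_tau_class l0 g : l0 \in dual [set: n] -> restrict l0 a = nu ->
  SInd (Ua * bistab Uh (tau nu))%g (alg_group [set: n])
    (fun u => \sum_(phi <- cls l0)
       multiplicity (bistab Uh (tau nu)) phi * #|` char_orbit Uh (tau nu)|%:R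
       * (tilde_S Ua (bistab Uh (tau nu)) phi u
          * tilde_a Ua (bistab Uh (tau nu)) (tau nu) u)) g
  = orbit_sum theta [set: n] l0 g.
Proof.
move=> dl0 l0_a; rewrite bistabE //; set O := #|` _|%:R.
pose f u : C := \sum_(phi <- cls l0) multiplicity (alg_group s) phi * O *
  (tilde_S Ua (alg_group s) phi u * tilde_a Ua (alg_group s) (tau nu) u).
rewrite -[LHS]/(SInd (Ua * alg_group s)%g (alg_group [set: n]) f g) /SInd.
have n_neq0 : #|[set: n]|%:R != 0 :> C := card_m_neq0 C (subalgT n).
have k_neq0 : #|radical nu|%:R != 0 :> C := card_m_neq0 C rad_alg.
have f_fiber u : (if u \in (Ua * alg_group s)%g then f u else 0) =
    O * #|radical nu|%:R / #|[set: n]|%:R *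
    \sum_(l in fiber l0) theta (l (minus1 u)).
  rewrite sum_fiber // OnePlusK mulrA.
  have -> : O * #|radical nu|%:R / #|[set: n]|%:R *
      (#|[set: n]|%:R / #|radical nu|%:R) = O by field; rewrite n_neq0 k_neq0.
  case: ifP => u_UaS; last by rewrite mulr0.
  have x_a := @mem_divgr _ (alg_group_group a_alg)
    (alg_group_group s_alg) _ u_UaS.
  have y_s := @mem_remgr _ (alg_group_group a_alg) (alg_group s) _ u_UaS.
  rewrite /f (eq_bigr (fun phi : {ffun algU n -> C} =>
      O * tau nu (divgr Ua (alg_group s) u) *
      (multiplicity (alg_group s) phi * phi (remgr Ua (alg_group s) u)))).
    rewrite -mulr_sumr (sum_multiplicity_supercharacters theta_char
      theta_nontrivial s_alg _ (@tau_class_sub _)) y_s ideal_characterE //.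
    by move: x_a; rewrite /= mem_alg_group => ->; rewrite mulrA.
  by move=> phi _; rewrite !ffunE mulrACA mulrC.
rewrite (eq_bigr (fun x => O * #|radical nu|%:R / #|[set: n]|%:R *
    \sum_(l in fiber l0) \sum_(y in alg_group [set: n])
      theta (l (biact x (minus1 g) y)))); last first.
  move=> x _; rewrite exchange_big mulr_sumr; apply: eq_bigr => y _ /=.
  exact: f_fiber.
rewrite -mulr_sumr exchange_big /=.
rewrite (eq_bigr (fun=> \sum_(x in alg_group [set: n])
  \sum_(y in alg_group [set: n]) theta (l0 (biact x (minus1 g) y)))).
  rewrite sumr_const alg_group_radical !card_alg_group -[_ *+ _]mulr_natl.
  have := orbit_average theta (subalgT n) l0 (minus1 g).
  rewrite -(card_char_orbit dl0 l0_a) natrM -/O.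
  rewrite -/(orbit_sum theta [set: n] l0 g).
  set S := \sum_(x in _) _ => avg.
  apply: (mulfI (expf_neq0 2 n_neq0)); rewrite -avg.
  by field; rewrite n_neq0 k_neq0.
move=> l; rewrite in_set => /andP[l_l0 _].
exact: (sum_biact_orbit theta (subalgT n) _ l_l0).
Qed.

End FixedCharacter.

(** * The correspondence *)

Section Correspondence.
Variable R : {fset {ffun algU n -> C}}.
Hypothesis R_representatives : orbit_representatives theta h a R.
Local Notation chi_n := (supercharacter theta [set: n]).
Local Notation s_of t := (bistab_alg Uh t).

(** Functionals indexing the supercharacters of U_n through the chosen
    representatives of the orbits of characters of U_a. *)
Definition normalized l := (l \in dual [set: n]) && (tau (restrict l a) \in R).

Definition orbit_class l :=
  let t := tau (restrict l a) in
  (char_orbit Uh t,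
   tau_class theta Uh t (supercharacter theta (s_of t) (restrict l (s_of t)))).

(** Each orbit of characters of U_a has a single representative in R. *)
Lemma normalized_unique l l' : normalized l -> normalized l' ->
    tau (restrict l a) \in char_orbit Uh (tau (restrict l' a)) ->
  restrict l a = restrict l' a.
Proof.
move=> /andP[dl Rl] /andP[dl' Rl'] l_l'.
have dl_a := restrict_a_dual dl; have dl'_a := restrict_a_dual dl'.
have sc_l : tau (restrict l a) \in supercharacters theta a.
  by apply/supercharactersP; exists (restrict l a).
have [t [_ t_unique]] := R_representatives.2 _ sc_l.
apply: (ideal_character_inj dl_a dl'_a).
rewrite -(t_unique _ (conj Rl' l_l')); apply/esym/t_unique; split=> //.
apply/char_orbit_restrict => //; exists l => //.
exact/dual_orbit_refl/subalgT.
Qed.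

Lemma exists_normalized l : l \in dual [set: n] ->
  exists2 l', normalized l' & l' \in dual_orbit [set: n] l.
Proof.
move=> dl; have dl_a := restrict_a_dual dl.
have sc_l : tau (restrict l a) \in supercharacters theta a.
  by apply/supercharactersP; exists (restrict l a).
have [t [[Rt t_orb] _]] := R_representatives.2 _ sc_l.
have /supercharactersP[nu dnu t_nu] := fsubsetP R_representatives.1 t Rt.
move: t_orb; rewrite t_nu => /(char_orbitP _ dnu)[x [y [Ux Uy eq_tau]]].
have eq_a : restrict l a = dual_act x nu y.
  by apply: ideal_character_inj eq_tau; rewrite ?dual_act_ideal.
exists (dual_act x^-1%g l y^-1%g).
  by rewrite /normalized dual_actT // restrict_ideal_act eq_a dual_actK -t_nu.
by rewrite dual_act_orbit // mem_alg_group inE.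
Qed.

Lemma orbit_class_eqP l l' : normalized l -> normalized l' ->
  reflect (orbit_class l = orbit_class l') (l \in dual_orbit [set: n] l').
Proof.
move=> nl nl'; have /andP[dl Rl] := nl; have /andP[dl' Rl'] := nl'.
have dnu := restrict_a_dual dl'; have Tn := subalgT n.
apply: (iffP idP) => [l_l' | eq_class].
  have eq_a : restrict l a = restrict l' a.
    apply: (normalized_unique nl nl').
    by apply/(char_orbit_restrict _ dl'); exists l.
  have eq_cls := elimT (tau_class_eqP dnu dl dl' eq_a erefl) l_l'.
  by rewrite /orbit_class eq_a (bistab_algE dnu) eq_cls.
have eq_orb : char_orbit Uh (tau (restrict l a))
    = char_orbit Uh (tau (restrict l' a)) := congr1 fst eq_class.
have eq_a : restrict l a = restrict l' a.
  apply: (normalized_unique nl nl'); rewrite -eq_orb.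
  by apply/(char_orbit_restrict _ dl); exists l; first exact: dual_orbit_refl.
apply/(tau_class_eqP dnu dl dl' eq_a erefl).
by have := congr1 snd eq_class; rewrite /orbit_class eq_a (bistab_algE dnu).
Qed.

Lemma exists_normalized_pair t psi : t \in R ->
    psi \in supercharacters theta (s_of t) ->
  exists l, [/\ normalized l, t = tau (restrict l a)
    & psi = supercharacter theta (s_of t) (restrict l (s_of t))].
Proof.
move=> Rt.
have /supercharactersP[nu dnu t_nu] := fsubsetP R_representatives.1 t Rt.
rewrite t_nu bistab_algE // => /supercharactersP[mu dmu ->].
have [l [dl l_s l_a]] := exists_functional_over dnu dmu.
by exists l; rewrite /normalized dl l_s l_a -t_nu.
Qed.

Lemma orbit_class_pairsP p : reflect
  (exists2 l, normalized l & p = orbit_class l)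
  (p \in orbit_class_pairs theta h R).
Proof.
apply: (iffP (imfset2P _ _ _ _ _)) => [[t Rt [psi psi_s ->]] | [l nl ->]].
  have [l [nl t_l psi_l]] := exists_normalized_pair Rt psi_s.
  by exists l; [exact: nl | rewrite /orbit_class -t_l -psi_l].
have /andP[dl Rl] := nl; exists (tau (restrict l a)) => //.
exists (supercharacter theta (s_of (tau (restrict l a)))
  (restrict l (s_of (tau (restrict l a))))) => //=.
apply/supercharactersP; eexists; last by [].
by rewrite bistab_algE ?restrict_s_dual ?restrict_a_dual.
Qed.

Definition class_of_supercharacter (chi : {ffun algU n -> C}) :=
  if [pick l | normalized l && (chi == chi_n l)] is Some l then orbit_class l
  else (fset0, fset0).

Definition supercharacter_of_class
    (p : {fset {ffun algU n -> C}} * {fset {ffun algU n -> C}}) :=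
  if [pick l | normalized l && (p == orbit_class l)] is Some l then chi_n l
  else [ffun=> 0].

Lemma class_of_supercharacterE l : normalized l ->
  class_of_supercharacter (chi_n l) = orbit_class l.
Proof.
move=> nl; rewrite /class_of_supercharacter.
case: pickP => [l' /andP[nl' /eqP eq_chi] | /(_ l)]; last by rewrite nl eqxx.
have /andP[dl _] := nl; have /andP[dl' _] := nl'.
apply/esym/orbit_class_eqP => //.
exact/(supercharacter_eqP theta_char theta_nontrivial (subalgT n) dl dl').
Qed.

Lemma supercharacter_of_classE l : normalized l ->
  supercharacter_of_class (orbit_class l) = chi_n l.
Proof.
move=> nl; rewrite /supercharacter_of_class.
case: pickP => [l' /andP[nl' /eqP eq_class] | /(_ l)]; last by rewrite nl eqxx.
have /andP[dl _] := nl; have /andP[dl' _] := nl'.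
apply/esym/(supercharacter_eqP theta_char theta_nontrivial (subalgT n) dl dl').
exact/orbit_class_eqP.
Qed.

Lemma normalized_supercharacterP chi : reflect
  (exists2 l, normalized l & chi = chi_n l)
  (chi \in supercharacters theta [set: n]).
Proof.
apply: (iffP (supercharactersP _ _ _)) => [[l dl ->] | [l /andP[dl _] ->]].
  have [l' nl' l'_l] := exists_normalized dl; exists l' => //.
  apply/esym/(supercharacter_eqP theta_char theta_nontrivial (subalgT n)) => //.
  by have /andP[] := nl'.
by exists l.
Qed.

(** Both sides of the identity are orbit sums, which distinguish orbits. *)
Lemma SInd_normalized l l' : normalized l -> l' \in dual [set: n] ->
  let t := tau (restrict l a) in
  let psi := supercharacter theta (s_of t) (restrict l (s_of t)) in
  chi_n l' = chi_n l <->
  forall g, multiplicity (alg_group [set: n]) (chi_n l') * chi_n l' g =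
    SInd (Ua * bistab Uh t)%g (alg_group [set: n])
      (fun u => \sum_(phi <- tau_class theta Uh t psi)
         multiplicity (bistab Uh t) phi * #|` char_orbit Uh t|%:R
         * (tilde_S Ua (bistab Uh t) phi u * tilde_a Ua (bistab Uh t) t u)) g.
Proof.
case/andP=> dl Rl dl' t psi; have dnu := restrict_a_dual dl.
have -> : psi = supercharacter theta (radical (restrict l a) :&: h)
    (restrict l (radical (restrict l a) :&: h)).
  by rewrite /psi /t bistab_algE.
have Tn := subalgT n.
have inT g : g \in alg_group [set: n] by rewrite mem_alg_group inE.
split=> [-> g | eq_sum].
  rewrite (multiplicity_mul_supercharacter theta_char theta_nontrivial Tn) //.
  by rewrite inT SInd_tau_class.
apply/(supercharacter_eqP theta_char theta_nontrivial (subalgT n)) => //.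
apply: (orbit_sum_inj theta_char theta_nontrivial (subalgT n)) => // g _.
have := eq_sum g.
rewrite (multiplicity_mul_supercharacter theta_char theta_nontrivial Tn) //.
by rewrite inT SInd_tau_class.
Qed.

Lemma sum_stabilizer_regular t g : t \in R ->
  \sum_(phi <- supercharacters theta (s_of t))
    multiplicity (bistab Uh t) phi * phi g
  = regular_character C (bistab Uh t) g.
Proof.
move=> Rt.
have /supercharactersP[nu dnu ->] := fsubsetP R_representatives.1 t Rt.
rewrite bistab_algE // bistabE //.
exact/sum_multiplicity_regular/radical_cap_subalgebra.
Qed.

End Correspondence.
End SemidirectProduct.

Theorem theorem6p1 (F : finFieldType) (n : nilAlgType F)
    (C : numClosedFieldType) (theta : F -> C)
    (h a : {set n}) (R : {fset {ffun algU n -> C}})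
    (theta_char : additive_character theta)
    (theta_nontrivial : exists t, theta t != 1)
    (h_subalgebra : subalgebra h) (a_subalgebra : subalgebra a)
    (Un_semidirect : (alg_group a ><| alg_group h)%g = alg_group [set: n])
    (Ua_supernormal : supernormal (alg_group a))
    (a_square_zero : {in a &, forall X Y, nmul X Y = 0})
    (R_representatives : orbit_representatives theta h a R) :
  let Un := alg_group [set: n] in
  let Ua := alg_group a in
  let Uh := alg_group h in
  let O := char_orbit Uh in
  let S := bistab Uh in
  let s := bistab_alg Uh in
  let cls := tau_class theta Uh in
  let pairs := orbit_class_pairs theta h R in
  [/\ forall chi, chi \in supercharacters theta [set: n] ->
        exists l, [/\ l \in dual [set: n],
                      chi = supercharacter theta [set: n] l
                    & supercharacter theta a (restrict l a) \in R],
      exists (Phi : {ffun algU n -> C} ->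
                {fset {ffun algU n -> C}} * {fset {ffun algU n -> C}})
             (Psi : {fset {ffun algU n -> C}} * {fset {ffun algU n -> C}} ->
                {ffun algU n -> C}),
        [/\ forall l, l \in dual [set: n] ->
              let tau := supercharacter theta a (restrict l a) in
              let psi := supercharacter theta (s tau) (restrict l (s tau)) in
              tau \in R ->
              Phi (supercharacter theta [set: n] l) = (O tau, cls tau psi),
            {in supercharacters theta [set: n], forall chi, Phi chi \in pairs}
            /\ {in pairs, forall p, Psi p \in supercharacters theta [set: n]},
            {in supercharacters theta [set: n], cancel Phi Psi},
            {in pairs, cancel Psi Phi}
          & forall tau psi, tau \in R -> psi \in supercharacters theta (s tau) ->
            forall chi, chi \in supercharacters theta [set: n] ->
              chi = Psi (O tau, cls tau psi) <->
              forall g, multiplicity Un chi * chi g =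
                SInd (Ua * S tau)%g Un
                  (fun u => \sum_(phi <- cls tau psi)
                     multiplicity (S tau) phi * #|` O tau|%:R
                       * (tilde_S Ua (S tau) phi u * tilde_a Ua (S tau) tau u))
                  g],
      forall g, \sum_(chi <- supercharacters theta [set: n])
                  multiplicity Un chi * chi g = regular_character C Un g
    & forall tau, tau \in R ->
      forall g, \sum_(phi <- supercharacters theta (s tau))
          multiplicity (S tau) phi * phi g = regular_character C (S tau) g].

Proof.
move=> Un Ua Uh O S s cls pairs.
have scP chi := normalized_supercharacterP theta_char theta_nontrivial
  a_subalgebra Ua_supernormal a_square_zero R_representatives chi.
have pairsP p := orbit_class_pairsP theta_char theta_nontrivial h_subalgebra
  a_subalgebra Un_semidirect Ua_supernormal a_square_zero R_representatives p.
have PhiE l := class_of_supercharacterE theta_char theta_nontrivial h_subalgebra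
  a_subalgebra Un_semidirect Ua_supernormal a_square_zero R_representatives
  (l := l).
have PsiE l := supercharacter_of_classE theta_char theta_nontrivial h_subalgebra
  a_subalgebra Un_semidirect Ua_supernormal a_square_zero R_representatives
  (l := l).
split.
- by move=> chi /scP[l /andP[dl Rl] ->]; exists l.
- exists (class_of_supercharacter theta h a R).
  exists (supercharacter_of_class theta h a R).
  split.
  + by move=> l dl t psi Rt; rewrite PhiE ?/normalized ?dl.
  + split=> [chi /scP[l nl ->] | p /pairsP[l nl ->]].
      by rewrite PhiE //; apply/pairsP; exists l.
    by rewrite PsiE //; apply/scP; exists l.
  + by move=> chi /scP[l nl ->]; rewrite PhiE // PsiE.
  + by move=> p /pairsP[l nl ->]; rewrite PsiE // PhiE.
  + move=> t psi Rt psi_s _ /scP[l' /andP[dl' _] ->].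
    have [l [nl t_l psi_l]] := exists_normalized_pair theta_char
      theta_nontrivial h_subalgebra a_subalgebra Un_semidirect Ua_supernormal
      a_square_zero R_representatives Rt psi_s.
    have -> : (O t, cls t psi) = orbit_class theta h a l.
      by rewrite /orbit_class -t_l -psi_l.
    rewrite PsiE // psi_l t_l.
    exact: (SInd_normalized theta_char theta_nontrivial h_subalgebra
      a_subalgebra Un_semidirect Ua_supernormal a_square_zero nl dl').
- exact: sum_multiplicity_regular (subalgT n).
- move=> t Rt g.
  exact: (sum_stabilizer_regular theta_char theta_nontrivial h_subalgebra
    a_subalgebra Ua_supernormal a_square_zero R_representatives g Rt).
Qed.
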